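(* Let $d\ge1$, $n\ge d$, let $X_1,\dots,X_n$ be $n$-exchangeable random vectors in $\mathbb R^d$, and let $S_k=X_1+\dots+X_k$, $1\le k\le n$, $S_0:=0$. Suppose that with probability one $S_1,\dots,S_n$ are in general position. Let $g:\mathbb R^{d\times(d-1)}\to\mathbb R$ be any non-negative Borel function and put $$G_n:=\sum_{f\in\mathcal F_n}g\bigl(S_{i_2(f)}-S_{i_1(f)},\dots,S_{i_d(f)}-S_{i_{d-1}(f)}\bigr).$$ Then $$\mathbb E G_n=2\sum_{1\le i_1<\dots<i_{d-1}\le n}\frac{\mathbb E\,g(S_{i_1},S_{i_2}-S_{i_1},\dots,S_{i_{d-1}}-S_{i_{d-2}})}{i_1(i_2-i_1)\cdots(i_{d-1}-i_{d-2})}.$$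
   Context: Random vectors $X_1,\dots,X_n$ are $n$-exchangeable if $(X_{\sigma(1)},\dots,X_{\sigma(n)})$ has the same distribution as $(X_1,\dots,X_n)$ for every permutation $\sigma$ of $\{1,\dots,n\}$. Vectors $S_1,\dots,S_n$ in $\mathbb R^d$ are in general position if any $d$ of them are linearly independent. $C_n:=\operatorname{conv}(S_0,S_1,\dots,S_n)$, and $\mathcal F_n$ is the set of all $(d-1)$-dimensional faces of the polytope $C_n$; almost surely each $f\in\mathcal F_n$ is a $(d-1)$-dimensional simplex of the form $f=\operatorname{conv}(S_{i_1(f)},\dots,S_{i_d(f)})$ with $0\le i_1(f)<\dots<i_d(f)\le n$, which defines the indices $i_j(f)$. *)

(* Defs.v *)
From HB Require Import structures.
From mathcomp Require Import all_boot all_order all_algebra all_fingroup.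
From mathcomp Require Import all_classical all_reals all_analysis.
Import Order.TTheory GRing.Theory Num.Theory.
Import numFieldNormedType.Exports.

Set Implicit Arguments.
Unset Strict Implicit.
Unset Printing Implicit Defensive.

Local Open Scope classical_set_scope.
Local Open Scope ring_scope.

(* [T] equipped with its Borel sigma-algebra. *)
Definition borel (T : ptopologicalType) := g_sigma_algebraType (@open T).

(* Vectors of R^d are rows, and a k-tuple of vectors is the matrix of its rows. *)

Section RandomVectors.
Context {dT : measure_display} {T : measurableType dT} {R : realType}.
Variables (P : probability T R) (d n : nat) (X : 'I_n -> T -> 'rV[R]_d).

(* The law on (R^d)^n is invariant under permutations of the vectors. *)
Definition exchangeable :=
  forall (s : 'S_n) (B : set (borel 'M[R]_(n, d))), measurable B ->
    pushforward P
      (fun w => \matrix_(i < n) X (s i) w : borel 'M[R]_(n, d)) B =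
    pushforward P
      (fun w => \matrix_(i < n) X i w : borel 'M[R]_(n, d)) B.

(* Ordinals start at 0, so [X i] is the (i+1)-st step of the walk and
   [partial_sum k w] is the sum of the first k steps, for k <= n. *)
Definition partial_sum (k : nat) (w : T) : 'rV[R]_d :=
  \sum_(i < n | (i < k)%N) X i w.

End RandomVectors.

Section Polytopes.
Context {R : realType} {d : nat}.
Implicit Types (A C F : set 'rV[R]_d) (S : nat -> 'rV[R]_d).

Definition convex_hull A : set 'rV[R]_d :=
  smallest (@convex_set R 'rV[R]_d) A.

(* The affine hull of [F] is [x0 + V]. *)
Definition has_affine_dim F (k : nat) :=
  exists (x0 : 'rV[R]_d) (V : {vspace 'rV[R]_d}),
    [/\ F x0,
        forall x, F x -> x - x0 \in V,
        forall W : {vspace 'rV[R]_d},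
          (forall x, F x -> x - x0 \in W) -> (V <= W)%VS &
        \dim V = k].

(* Faces in the sense of polytopes: [u = 0] gives [C] itself and the empty
   face. *)
Definition is_face C F :=
  exists (u : 'cV[R]_d) (c : R),
    (forall x, C x -> (x *m u) 0 0 <= c) /\
    F = [set x | C x /\ (x *m u) 0 0 = c].

Definition facets C : set (set 'rV[R]_d) :=
  [set F | is_face C F /\ has_affine_dim F d.-1].

Definition general_position n S :=
  forall I : {set 'I_n}, #|I| = d -> free [seq S i.+1 | i : 'I_n <- enum I].

Definition walk_hull n S : set 'rV[R]_d :=
  convex_hull [set S k | k in [set k : nat | (k <= n)%N]].

(* The increasing indices i_1 < ... < i_d in {0, ..., n} such that
   [F = conv {S i_1, ..., S i_d}]. The default value is only used when [F] has
   no such representation. *)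
Definition facet_indices n S F : d.-tuple 'I_n.+1 :=
  xget (nseq_tuple d ord0)
    [set i : d.-tuple 'I_n.+1 |
      sorted ltn (map val i) /\
      F = convex_hull [set S (val k) | k in [set k : 'I_n.+1 | k \in i]]].

(* For [s] of size [d], the [d - 1] successive differences
   [S s_2 - S s_1, ..., S s_d - S s_(d-1)]. *)
Definition increments S (s : seq nat) : 'M[R]_(d.-1, d) :=
  \matrix_(j < d.-1) (S (nth 0%N s j.+1) - S (nth 0%N s j)).

Definition facet_sum n (g : 'M[R]_(d.-1, d) -> R) S : R :=
  \sum_(F \in facets (walk_hull n S))
    g (increments S (map val (facet_indices n S F))).

End Polytopes.

(* Main.v *)
(** Almost surely every permuted walk is in general position, so a facet of the
    hull is a simplex [conv {S_i1, ..., S_id}] such that all [S_k] lie on one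
    side of the hyperplane through it. Let [u] be the normal of this hyperplane.
    Permuting the steps so that the block of steps between [i_1] and [i_d]
    comes first does not change the increments of the facet, and turns the
    one-sidedness into two conditions: the projection to [u] of each of the
    [d - 1] segments of the block is a nonnegative bridge, and the walk that
    follows the block has its minimum in direction [u] at the place given by
    [i_1]. Summing over [i_1] removes the second condition, as the minimum is
    unique. Cyclically shifting the steps of one segment of length [l], exactly
    one of the [l] shifts makes its bridge nonnegative, which gives the factor
    [1 / l]. The factor 2 comes from the two sides of the hyperplane.

    All of this is an identity between sums over the permutations of the steps
    of a fixed walk; exchangeability is used to average over permutations. *)

Require Import Defs.
From HB Require Import structures.
From mathcomp Require Import all_boot all_order all_algebra all_fingroup.
From mathcomp Require Import all_classical all_reals all_analysis.
From mathcomp Require Import measurable_realfun zify lra.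
Import Order.TTheory GRing.Theory Num.Theory.
Import numFieldNormedType.Exports.

Set Implicit Arguments.
Unset Strict Implicit.
Unset Printing Implicit Defensive.

Local Open Scope classical_set_scope.
Local Open Scope ring_scope.

(** * Block swaps and walks *)

Ltac case_ifs := repeat match goal with
  |- context [if (?a < ?b)%N then _ else _] => case: (ltnP a b) => ? end.

Section BlockSwap.
Variables (n p q r : nat).
Hypotheses (pq : (p <= q)%N) (qr : (q <= r)%N) (rn : (r <= n)%N).

(** Exchanges the adjacent blocks of steps [[p, q)] and [[q, r)], keeping the order inside each.
    Moving a block and shifting a block cyclically are both of this form. *)
Definition block_swap_nat (k : nat) : nat :=
  if (k < p)%N then k else if (k < p + (r - q))%N then (k - p + q)%N
  else if (k < r)%N then (k - (r - q))%N else k.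

Lemma block_swap_subproof (i : 'I_n) : (block_swap_nat i < n)%N.
Proof. by have := ltn_ord i; rewrite /block_swap_nat; case_ifs; lia. Qed.

Lemma block_swap_inj : injective (fun i => Ordinal (block_swap_subproof i)).
Proof.
move=> i j [] /eqP; rewrite /block_swap_nat => ij; apply/val_inj => /=.
by move: ij; case_ifs; lia.
Qed.

Definition block_swap : 'S_n := perm block_swap_inj.

End BlockSwap.

Section Walk.
Context {R : realType} {n d : nat}.
Implicit Types x : 'M[R]_(n, d).

Definition walk x (k : nat) : 'rV[R]_d := \sum_(i < n | (i < k)%N) row i x.

Lemma walk0 x : walk x 0 = 0.
Proof. by rewrite /walk big_pred0. Qed.

Lemma walkS x (i : 'I_n) : walk x i.+1 = walk x i + row i x.
Proof.
rewrite /walk (bigD1 i) //= addrC; congr (_ + _).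
by apply: eq_bigl => j; rewrite ltnS ltn_neqAle andbC.
Qed.

Section BlockSwapWalk.
Variables (p q r : nat).
Hypotheses (pq : (p <= q)%N) (qr : (q <= r)%N) (rn : (r <= n)%N).
Variable x : 'M[R]_(n, d).

Let y := row_perm (block_swap pq qr rn) x.

Let walk_step (k m : nat) (kn : (k < n)%N) (mn : (m < n)%N) :
  block_swap_nat p q r k = m -> walk y k.+1 - walk y k = walk x m.+1 - walk x m.
Proof.
move=> km; rewrite (walkS y (Ordinal kn)) (walkS x (Ordinal mn)) /=.
rewrite ![_ + _ - _]addrAC !subrr !add0r.
have <- : block_swap pq qr rn (Ordinal kn) = Ordinal mn.
  by apply: val_inj; rewrite permE.
by apply/rowP => j; rewrite !mxE.
Qed.

Lemma walk_block_swap_le k : (k <= p)%N -> walk y k = walk x k.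
Proof.
elim: k => [|k IH] kp; first by rewrite !walk0.
have kn : (k < n)%N by lia.
have -> : walk y k.+1 = walk y k + (walk y k.+1 - walk y k) by rewrite subrKC.
rewrite (walk_step kn kn); last by rewrite /block_swap_nat; case_ifs; lia.
by rewrite IH ?subrKC //; lia.
Qed.

Lemma walk_block_swap_fst t : (t <= r - q)%N ->
  walk y (p + t) = walk x p + (walk x (q + t) - walk x q).
Proof.
elim: t => [|t IH] tr.
  by rewrite !addn0 subrr addr0 walk_block_swap_le.
have kn : (p + t < n)%N by lia.
have mn : (q + t < n)%N by lia.
have -> : walk y (p + t.+1)%N =
    walk y (p + t) + (walk y (p + t.+1)%N - walk y (p + t)).
  by rewrite subrKC.
rewrite addnS (walk_step kn mn); last first.
  by rewrite /block_swap_nat; case_ifs; lia.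
rewrite IH ?addnS; last by lia.
by rewrite -[LHS]addrA; congr (_ + _); rewrite addrC subrKA.
Qed.

Lemma walk_block_swap_snd t : (t <= q - p)%N ->
  walk y (p + (r - q) + t) = walk x r - walk x q + walk x (p + t).
Proof.
elim: t => [|t IH] tr.
  rewrite !addn0 walk_block_swap_fst // addrC; congr (_ - _ + _); congr walk; lia.
have kn : (p + (r - q) + t < n)%N by lia.
have mn : (p + t < n)%N by lia.
have -> : walk y (p + (r - q) + t.+1)%N = walk y (p + (r - q) + t)
   + (walk y (p + (r - q) + t.+1)%N - walk y (p + (r - q) + t)).
  by rewrite subrKC.
rewrite !addnS (walk_step kn mn); last first.
  by rewrite /block_swap_nat; case_ifs; lia.
by rewrite IH ?addrA ?subrK -?addrA ?subrKC //; lia.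
Qed.

Lemma walk_block_swap_ge k : (r <= k <= n)%N -> walk y k = walk x k.
Proof.
move=> /andP[rk kn].
have -> : k = (r + (k - r))%N by lia.
have : (k - r <= n - r)%N by lia.
elim: (k - r)%N => [|t IH] tn.
  rewrite addn0; have := @walk_block_swap_snd (q - p) (leqnn _).
  rewrite (_ : p + (r - q) + (q - p) = r)%N; last by lia.
  by rewrite subnKC // subrK.
have mn : (r + t < n)%N by lia.
have -> : walk y (r + t.+1)%N =
    walk y (r + t) + (walk y (r + t.+1)%N - walk y (r + t)).
  by rewrite subrKC.
rewrite !addnS (walk_step mn mn); last first.
  by rewrite /block_swap_nat; case_ifs; lia.
by rewrite IH ?subrKC //; lia.
Qed.

End BlockSwapWalk.

(** Multiplication by [s] is a bijection of the symmetric group, so a fixed rearrangement may be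
    inserted under any sum over all permutations. *)
Lemma sum_row_perm (V : nmodType) (F : 'M[R]_(n, d) -> V) (s : 'S_n) x :
  \sum_(t : 'S_n) F (row_perm t x) =
  \sum_(t : 'S_n) F (row_perm s (row_perm t x)).
Proof.
rewrite (reindex_inj (mulgI s)) /=.
by apply: eq_bigr => t _; rewrite row_permM.
Qed.

End Walk.

(** Distinct values have a single minimiser. Both counting arguments below, for the start of the
    block and for the cyclic shift, end here. *)
Lemma sum_argmin (R : realDomainType) (m : nat) (f : nat -> R) :
  (0 < m)%N -> {in gtn m &, injective f} ->
  (\sum_(c < m) [forall k : 'I_m, (f c <= f k)%R] = 1)%N.
Proof.
case: m => // m _ finj.
pose c0 := [arg min_(c < (ord0 : 'I_m.+1)) f c]%O.
have c0P k : f c0 <= f (k : 'I_m.+1).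
  by rewrite /c0; case: arg_minP => // i _; apply.
rewrite (bigD1 c0) //= big1 ?addn0 => [|c cc0].
  by have -> : [forall k : 'I_m.+1, f c0 <= f k] by apply/forallP.
apply/eqP; rewrite eqb0; apply: contra cc0 => /forallP /(_ c0) cle.
apply/eqP/val_inj/finj; rewrite ?unfold_in /= //.
by apply/le_anti/andP; split; [exact: cle | exact: c0P].
Qed.

(** * Normals and general position *)

Section Pairing.
Context {R : realType} {d : nat}.
Implicit Types (x y : 'rV[R]_d) (u : 'cV[R]_d).

Definition pairing x u : R := (x *m u) 0 0.

Lemma pairingD x y u : pairing (x + y) u = pairing x u + pairing y u.
Proof. by rewrite /pairing mulmxDl mxE. Qed.

Lemma pairingB x y u : pairing (x - y) u = pairing x u - pairing y u.
Proof. by rewrite /pairing mulmxBl !mxE. Qed.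

Lemma pairingZ a x u : pairing (a *: x) u = a * pairing x u.
Proof. by rewrite /pairing -scalemxAl mxE. Qed.

End Pairing.

Section Normal.
Context {R : realType} {d : nat}.
Implicit Types (D : 'M[R]_(d, d.+1)) (v : 'rV[R]_d.+1).

(* The generalised cross product of the rows of [D]. *)
Definition normal D : 'cV[R]_d.+1 :=
  \col_j cofactor (col_mx 0 D : 'M[R]_(1 + d)) 0 j.

Definition height D v : R := pairing v (normal D).

(** Expansion along the first row, whose cofactors do not see that row; this is why [normal] may put
    0 there. *)
Lemma height_det D v : height D v = \det (col_mx v D : 'M[R]_(1 + d)).
Proof.
rewrite (expand_det_row _ 0) /height /pairing mxE; apply: eq_bigr => j _.
rewrite !mxE; case: splitP => [k _ | k /eqP //]; rewrite !ord1; congr (_ * _).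
rewrite /cofactor; congr (_ * \det _); apply/matrixP => a b; rewrite !mxE.
by case: splitP => k' //; rewrite ord1.
Qed.

Lemma heightD D v w : height D (v + w) = height D v + height D w.
Proof. exact: pairingD. Qed.

Lemma heightB D v w : height D (v - w) = height D v - height D w.
Proof. exact: pairingB. Qed.

Lemma height0 D : height D 0 = 0.
Proof. by rewrite /height /pairing mul0mx mxE. Qed.

Lemma height_row D i : height D (row i D) = 0.
Proof.
rewrite height_det.
apply: (@determinant_alternate _ _ _ (lshift d 0) (rshift 1 i)).
  by rewrite eq_lrshift.
by move=> j; rewrite col_mxEu col_mxEd mxE.
Qed.

End Normal.

Section AffineGeneral.
Context {R : realType} {d : nat} (n : nat) (S : nat -> 'rV[R]_d.+1).
Implicit Types (s : seq nat) (u : 'cV[R]_d.+1).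

(** General position in the affine sense, with [S 0] among the points and ambient dimension [d.+1].
    Indices are counted, so coincident points count separately. *)
Definition affine_general :=
  forall u c, u != 0 ->
    (#|[pred k : 'I_n.+1 | (S k *m u) 0%R 0%R == c]| <= d.+1)%N.

Hypothesis agS : affine_general.

Lemma affine_general_size u c s : u != 0 -> uniq s ->
  {in s, forall k, (k <= n)%N /\ (S k *m u) 0 0 = c} -> (size s <= d.+1)%N.
Proof.
move=> u0 us sP; apply: leq_trans (agS c u0).
rewrite cardE -(size_map (@inord n)); apply: uniq_leq_size.
  rewrite map_inj_in_uniq // => a b /sP[an _] /sP[bn _] /(congr1 val) /=.
  by rewrite !inordK.
move=> _ /mapP[k /sP[kn kc] ->]; rewrite mem_enum inE /= inordK ?ltnS //.
exact/eqP.
Qed.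

Lemma increments_mul_eq0 u s : size s = d.+1 -> increments S s *m u = 0 ->
  {in s, forall k, (S k *m u) 0 0 = (S (nth 0%N s 0) *m u) 0 0}.
Proof.
move=> ss Du k /(nthP 0%N)[i]; rewrite ss => + <-.
elim: i => [//|i IH] id; rewrite -IH ?(ltnW id) //.
have : (row (Ordinal (id : (i < d)%N)) (increments S s) *m u) 0 0 = 0.
  by rewrite -row_mul Du !mxE.
by rewrite rowK mulmxBl !mxE => /eqP; rewrite subr_eq0 => /eqP.
Qed.

(** A vanishing determinant yields a nonzero functional that is constant on the increments and on
    the step to [S k], hence on the [d.+2] points of [k :: s]. *)
Lemma height_neq0 s k : size s = d.+1 -> uniq s -> {in s, forall m, (m <= n)%N} ->
  (k <= n)%N -> k \notin s ->
  height (increments S s) (S k - S (nth 0%N s 0)) != 0.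
Proof.
move=> ss us sn kn ks; rewrite height_det -det_tr.
apply/det0P => -[v v0 vD].
pose u := v^T; have u0 : u != 0 by rewrite -(inj_eq trmx_inj) trmxK trmx0.
have : col_mx (S k - S (nth 0%N s 0)) (increments S s) *m u = 0.
  by apply: trmx_inj; rewrite trmx_mul trmxK trmx0.
rewrite mul_col_mx -[0]vsubmxK => /eq_col_mx[]; rewrite !linear0 => ku Du.
have su := increments_mul_eq0 ss Du.
suff: (size (k :: s) <= d.+1)%N by rewrite /= ss ltnn.
apply: (@affine_general_size u ((S (nth 0%N s 0) *m u) 0 0)) => //=.
  by rewrite ks.
move=> m; rewrite inE => /predU1P[->|ms]; last by rewrite su // sn.
split=> //; apply/eqP; rewrite -subr_eq0.
by move: ku => /(congr1 (fun M : 'M[R]_1 => M 0 0)); rewrite mulmxBl !mxE => ->.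
Qed.

Lemma height_node s k : size s = d.+1 -> k \in s ->
  height (increments S s) (S k - S (nth 0%N s 0)) = 0.
Proof.
move=> ss ks.
have Du : increments S s *m normal (increments S s) = 0.
  apply/matrixP => i j; rewrite ord1 [RHS]mxE.
  by have := height_row (increments S s) i; rewrite /height /pairing -row_mul mxE.
rewrite heightB; apply/eqP; rewrite subr_eq0 /height /pairing.
by rewrite (increments_mul_eq0 ss Du ks).
Qed.

End AffineGeneral.

(** * Averaging over permutations of the steps *)

Section Rearrangement.
Context {R : realType} {n d : nat}.
Implicit Types (x : 'M[R]_(n, d.+1)) (s : seq nat).

(** Asked for every order of the steps, because [height_neq0] is applied to rearranged walks. *)
Definition affine_general_perm x :=
  forall t : 'S_n, affine_general n (walk (row_perm t x)).

Lemma affine_general_permJ x t :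
  affine_general_perm x -> affine_general_perm (row_perm t x).
Proof. by move=> gx t'; rewrite -row_permM; apply: gx. Qed.

Lemma eq_increments (S S' : nat -> 'rV[R]_d.+1) s v : size s = d.+1 ->
  {in s, forall m, S' m = v + S m} -> increments S' s = increments S s.
Proof.
move=> ss SS'; apply/row_matrixP => j; rewrite !rowK.
rewrite !SS' ?mem_nth ?ss ?ltnS ?[(j <= _)%N]ltnW //.
by rewrite opprD addrACA subrr add0r.
Qed.

Lemma increments_shift (S : nat -> 'rV[R]_d.+1) s a : size s = d.+1 ->
  increments S [seq (a + m)%N | m <- s] = increments (fun m => S (a + m)%N) s.
Proof.
move=> ss; apply/row_matrixP => j; rewrite !rowK !(nth_map 0%N) ?ss ?ltnS //.
exact/ltnW.
Qed.

(** The indices of a simplex, translated to start at 0; [sum_block_start] sums over the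
    translations. *)
Variables (s : seq nat).
Hypotheses (ss : size s = d.+1) (s_sorted : sorted ltn s) (s0 : nth 0%N s 0 = 0%N)
  (sn : (last 0%N s <= n)%N).

Let s_le m : m \in s -> (m <= last 0%N s)%N.
Proof.
move=> /(nthP 0%N)[i]; rewrite -nth_last ss => id <-.
apply: (sorted_leq_nth leq_trans leqnn); rewrite ?inE ?ss //.
by apply: sub_sorted s_sorted => a b; exact: ltnW.
Qed.

(** Swapping the blocks [[p, a)] and [[a, b)] fixes the walk at all indices of [s] and puts
    [walk x p + (walk x b - walk x a)] at the index [p + (b - a)] outside [s]. Equal heights would
    place this point on the hyperplane of the simplex. *)
Lemma height_neq x p a b : affine_general_perm x -> p \in s ->
  (p <= a)%N -> (a < b)%N -> (b <= n)%N ->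
  {in s, forall m, (m <= p)%N || (b < m)%N} ->
  height (increments (walk x) s) (walk x a) !=
  height (increments (walk x) s) (walk x b).
Proof.
move=> gx ps pa ab bn sP.
pose y := row_perm (block_swap pa (ltnW ab) bn) x.
have yE : {in s, forall m, walk y m = walk x m}.
  move=> m ms; case/orP: (sP m ms) => [mp|bm].
    by rewrite walk_block_swap_le.
  rewrite walk_block_swap_ge // (ltnW bm) (leq_trans _ sn) //; exact: s_le.
have := @height_neq0 _ _ n (walk y) (gx _) s (p + (b - a)) ss.
rewrite (@eq_increments (walk x) _ _ 0) // => [|m ms]; last by rewrite add0r yE.
rewrite s0 walk0 subr0 walk_block_swap_fst // subnKC ?(ltnW ab) //.
have h0 : height (increments (walk x) s) (walk x p) = 0.
  have := height_node (walk x) ss ps.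
  by rewrite s0 walk0 subr0.
rewrite heightD h0 add0r heightB subr_eq0 eq_sym; apply.
- exact: sorted_uniq ltn_trans ltnn _ s_sorted.
- by move=> m /s_le ml; exact: leq_trans ml sn.
- by lia.
- by apply/negP => /sP; lia.
Qed.

Variables (g : 'M[R]_(d, d.+1) -> R) (e : R).
Hypothesis e0 : e != 0.

(** The sign of [e] chooses the side of the hyperplane; the values 1 and -1 are used later. *)
Definition on_one_side (S : nat -> 'rV[R]_d.+1) (r : seq nat) : bool :=
  [forall k : 'I_n.+1,
    0 <= e * height (increments S r) (S k - S (nth 0%N r 0))].

(** Heights vanish at the indices of [s], so for [m] in [s] this says that the bridges of all
    segments up to [m] are nonnegative. *)
Definition nonneg_upto x (m : nat) : bool :=
  [forall k : 'I_m.+1, 0 <= e * height (increments (walk x) s) (walk x k)].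

(* Moving the block of steps with indices [a + 1 .. a + last 0 s] to the front
   turns [a] into the place of the minimum of the rest of the walk. *)
Lemma sum_block_start x : affine_general_perm x ->
  \sum_(a < (n - last 0 s).+1) \sum_(t : 'S_n)
    (let y := row_perm t x in let r := [seq (a + m)%N | m <- s] in
     g (increments (walk y) r) * (on_one_side (walk y) r)%:R) =
  \sum_(t : 'S_n)
    (let y := row_perm t x in
     g (increments (walk y) s) * (nonneg_upto y (last 0 s))%:R).
Proof.
move=> gx; set L := last 0%N s.
have La (a : 'I_(n - L).+1) : (L + a <= n)%N by have := ltn_ord a; lia.
(* [tau a] moves the first [L] steps behind the [a] steps that follow them, so the shifted indices
   [a + m] see the same increments as [s] in [y]. *)
pose tau (a : 'I_(n - L).+1) := block_swap (leq0n L) (leq_addr a L) (La a).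
pose F x r := g (increments (walk x) r) * (on_one_side (walk x) r)%:R.
transitivity (\sum_(a < (n - L).+1) \sum_(t : 'S_n)
   F (row_perm (tau a) (row_perm t x)) [seq (a + m)%N | m <- s]).
  apply: eq_bigr => a _.
  exact: (sum_row_perm (fun y => F y [seq (a + m)%N | m <- s]) (tau a)).
rewrite exchange_big; apply: eq_bigr => t _ /=.
set y := row_perm t x.
have gy : affine_general_perm y by exact: affine_general_permJ.
pose f m := e * height (increments (walk y) s) (walk y (L + m)).
have y_lo (a : 'I_(n - L).+1) k : (k <= a)%N ->
    walk (row_perm (tau a) y) k = walk y (L + k) - walk y L.
  move=> ka; have := walk_block_swap_fst (leq0n L) (leq_addr a L) (La a) y (t := k).
  by rewrite add0n walk0 add0r; apply; lia.
have y_mid (a : 'I_(n - L).+1) k : (k <= L)%N ->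
    walk (row_perm (tau a) y) (a + k) = walk y (L + a) - walk y L + walk y k.
  move=> kL; have := walk_block_swap_snd (leq0n L) (leq_addr a L) (La a) y (t := k).
  by rewrite add0n (_ : L + a - L = a)%N; [apply; lia|lia].
have y_hi (a : 'I_(n - L).+1) k : (L + a <= k <= n)%N ->
    walk (row_perm (tau a) y) k = walk y k.
  by move=> ka; rewrite walk_block_swap_ge.
have Lin : L \in s.
  by rewrite /L -nth_last mem_nth // ss.
have hL : height (increments (walk y) s) (walk y L) = 0.
  by have := height_node (walk y) ss Lin; rewrite s0 walk0 subr0.
have incE (a : 'I_(n - L).+1) :
    increments (walk (row_perm (tau a) y)) [seq (a + m)%N | m <- s] =
    increments (walk y) s.
  rewrite increments_shift //.
  by apply: eq_increments => // m /s_le mL; exact: y_mid.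
(* Relative to time [a], the swapped walk has signed heights [f k - f a] at times [k <= a], those of
   the block at times from [a] to [a + L], and [f (k - L) - f a] at later times [k]. *)
transitivity (\sum_(a < (n - L).+1) g (increments (walk y) s) *
   (nonneg_upto y L)%:R * ([forall k : 'I_(n - L).+1, f a <= f k])%:R).
  apply: eq_bigr => a _; rewrite /F incE -mulrA -natrM mulnb; congr (_ * _%:R).
  congr nat_of_bool; rewrite /on_one_side incE.
  rewrite (nth_map 0%N) ?ss // s0.
  have -> : walk (row_perm (tau a) y) (a + 0) = walk y (L + a) - walk y L.
    by rewrite y_mid // walk0 addr0.
  apply/forallP/andP => [h|[/forallP h1 /forallP h2] k].
    split; apply/forallP => k.
      have kn : (a + k < n.+1)%N by have := ltn_ord k; have := La a; lia.
      have := h (Ordinal kn); rewrite /= y_mid -1?ltnS //.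
      by rewrite addrAC subrr add0r.
    have [ka|ak] := leqP k a.
      have kn : (k < n.+1)%N by have := La a; lia.
      have := h (Ordinal kn); rewrite /= y_lo // opprB subrKA.
      by rewrite heightB mulrBr subr_ge0.
    have kn : (L + k < n.+1)%N by have := ltn_ord k; lia.
    have := h (Ordinal kn); rewrite /= y_hi; last by lia.
    by rewrite !heightB hL subr0 mulrBr subr_ge0.
  have kn := ltn_ord k.
  have [ka|ak] := leqP k a.
    rewrite y_lo // opprB subrKA heightB mulrBr subr_ge0.
    have kL : (k < (n - L).+1)%N by have := ltn_ord a; lia.
    exact: (h2 (Ordinal kL)).
  have [kaL|aLk] := leqP k (a + L).
    have -> : (k = a + (k - a) :> nat)%N by lia.
    rewrite y_mid ?[_ + walk y _]addrC ?addrK; last by lia.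
    have kL : (k - a < L.+1)%N by lia.
    exact: (h1 (Ordinal kL)).
  rewrite y_hi; last by lia.
  have kL : (k - L < (n - L).+1)%N by lia.
  have := h2 (Ordinal kL); rewrite /f /= subnKC; last by lia.
  by rewrite !heightB hL subr0 mulrBr subr_ge0.
rewrite -mulr_sumr -natr_sum sum_argmin ?mulr1 // => a b.
rewrite !unfold_in /= => an bn fab.
wlog ab : a b an bn fab / (a < b)%N.
  by move=> wl; case: (ltngtP a b) => // ?; [|symmetry]; exact: wl.
suff /eqP[] : height (increments (walk y) s) (walk y (L + a)) !=
  height (increments (walk y) s) (walk y (L + b)) by exact: mulfI e0 _ _ fab.
apply: (@height_neq y L) => //; [lia|lia|lia|].
by move=> m /s_le ->.
Qed.

(* Exactly one cyclic shift of the steps of the block makes its bridge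
   nonnegative. *)
Lemma sum_block_bridge x b : affine_general_perm x -> (b < d)%N ->
  (nth 0%N s b.+1 - nth 0%N s b)%:R * \sum_(t : 'S_n)
    (let y := row_perm t x in
     g (increments (walk y) s) * (nonneg_upto y (nth 0%N s b.+1))%:R) =
  \sum_(t : 'S_n)
    (let y := row_perm t x in
     g (increments (walk y) s) * (nonneg_upto y (nth 0%N s b))%:R).
Proof.
move=> gx bd; set p := nth 0%N s b; set r := nth 0%N s b.+1.
have nth_lt i j : (i < j)%N -> (j < d.+1)%N -> (nth 0%N s i < nth 0%N s j)%N.
  move=> ij jd; apply: (sorted_ltn_nth ltn_trans) => //; rewrite inE ss //.
  exact: ltn_trans jd.
have pr : (p < r)%N by exact: nth_lt.
have ps : p \in s by rewrite mem_nth ?ss // ltnS ltnW.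
have rs : r \in s by rewrite mem_nth ?ss.
have rn : (r <= n)%N by exact: leq_trans (s_le rs) sn.
have s_out : {in s, forall m, (m <= p)%N || (r <= m)%N}.
  move=> m /(nthP 0%N)[i]; rewrite ss => id <-.
  have [ib|bi|->] := ltngtP i b; last by rewrite leqnn.
    by rewrite ltnW // nth_lt // ltnW.
  have [->|bi'] := eqVneq i b.+1; first by rewrite leqnn orbT.
  by rewrite [(r <= _)%N]ltnW ?orbT // nth_lt // ltn_neqAle eq_sym bi'.
pose l := (r - p)%N.
have qr (c : 'I_l) : (p + c <= r)%N by have := ltn_ord c; rewrite /l; lia.
(* [tau c] shifts the steps of the segment cyclically by [c]. The walk keeps its values at the
   indices of [s], hence the hyperplane is unchanged. *)
pose tau (c : 'I_l) := block_swap (leq_addr c p) (qr c) rn.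
pose F x := g (increments (walk x) s) * (nonneg_upto x r)%:R.
transitivity (\sum_(c < l) \sum_(t : 'S_n) F (row_perm (tau c) (row_perm t x))).
  transitivity (\sum_(c < l) \sum_(t : 'S_n) F (row_perm t x)).
    by rewrite sumr_const card_ord -/l mulr_natl.
  by apply: eq_bigr => c _; exact: (sum_row_perm F (tau c)).
rewrite exchange_big; apply: eq_bigr => t _ /=.
set y := row_perm t x.
have gy : affine_general_perm y by exact: affine_general_permJ.
pose h k := height (increments (walk y) s) (walk y k).
have hp : h p = 0.
  by have := height_node (walk y) ss ps; rewrite s0 walk0 subr0.
have hr : h r = 0.
  by have := height_node (walk y) ss rs; rewrite s0 walk0 subr0.
have incE (c : 'I_l) : increments (walk (row_perm (tau c) y)) s =
    increments (walk y) s.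
  apply: (@eq_increments _ _ _ 0) => // m ms; rewrite add0r.
  case/orP: (s_out m ms) => [mp|rm]; first by rewrite walk_block_swap_le.
  by rewrite walk_block_swap_ge // rm (leq_trans (s_le ms)).
pose h' c k := height (increments (walk y) s) (walk (row_perm (tau c) y) k).
have h_lo c k : (k <= p)%N -> h' c k = h k.
  by move=> kp; rewrite /h' walk_block_swap_le.
have h_fst (c : 'I_l) k : (p + c + k <= r)%N ->
    h' c (p + k)%N = h (p + c + k)%N - h (p + c)%N.
  move=> kr; rewrite /h' walk_block_swap_fst; last by lia.
  by rewrite heightD heightB -/(h p) hp add0r.
have h_snd (c : 'I_l) k : (k <= c)%N ->
    h' c (r - c + k)%N = h (p + k)%N - h (p + c)%N.
  move=> kc; have -> : (r - c + k = p + (r - (p + c)) + k)%N by have := qr c; lia.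
  rewrite /h' walk_block_swap_snd; last by lia.
  by rewrite heightD heightB -/(h r) hr sub0r addrC.
pose f k := e * h (p + k)%N.
(* The shifted bridge starts at time [p + c] of the old one, so its heights are differences with
   [h (p + c)]. They have the right sign exactly if [f] is minimal at [c]. *)
transitivity (\sum_(c < l) g (increments (walk y) s) *
   (nonneg_upto y p)%:R * ([forall k : 'I_l, f c <= f k])%:R).
  apply: eq_bigr => c _; rewrite /F incE -mulrA -natrM mulnb; congr (_ * _%:R).
  congr nat_of_bool; rewrite /nonneg_upto incE.
  have cl := ltn_ord c.
  apply/forallP/andP => [H|[/forallP h1 /forallP h2] k].
    split; apply/forallP => k.
      have kn : (k < r.+1)%N by have := ltn_ord k; lia.
      by have := H (Ordinal kn); rewrite /= -/(h' c k) h_lo // -ltnS.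
    have kl := ltn_ord k.
    rewrite -subr_ge0 -mulrBr.
    have [ck|kc] := leqP c k.
      have kn : (p + (k - c) < r.+1)%N by lia.
      have := H (Ordinal kn); rewrite /= -/(h' c _) h_fst; last by lia.
      by rewrite -addnA subnKC.
    have kn : (r - c + k < r.+1)%N by lia.
    by have := H (Ordinal kn); rewrite /= -/(h' c _) h_snd // ltnW.
  have kr := ltn_ord k; rewrite -/(h' c k).
  have [kp|pk] := leqP k p.
    rewrite h_lo //.
    have kn : (k < p.+1)%N by lia.
    exact: (h1 (Ordinal kn)).
  have [kfst|ksnd] := leqP k (r - c).
    have -> : (k = p + (k - p) :> nat)%N by lia.
    rewrite h_fst; last by lia.
    rewrite mulrBr subr_ge0.
    have [kl|kl] := ltnP (c + (k - p)) l.
      by have := h2 (Ordinal kl); rewrite /f /= addnA.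
    (* [f] is compared only at indices below [l]; the end [r] of the segment is covered by index 0,
       since [h p] and [h r] both vanish. *)
    have -> : (p + c + (k - p) = r)%N by lia.
    have l0 : (0 < l)%N by lia.
    by have := h2 (Ordinal l0); rewrite /f /= addn0 hp hr.
  have -> : (k = r - c + (k - (r - c)) :> nat)%N by lia.
  rewrite h_snd; last by lia.
  rewrite mulrBr subr_ge0.
  have kl : (k - (r - c) < l)%N by lia.
  exact: (h2 (Ordinal kl)).
rewrite -mulr_sumr -natr_sum sum_argmin ?mulr1 //; first by lia.
move=> i j; rewrite !unfold_in /= => il jl fij.
wlog ij : i j il jl fij / (i < j)%N.
  by move=> wl; case: (ltngtP i j) => // ?; [|symmetry]; exact: wl.
suff /eqP[] : h (p + i)%N != h (p + j)%N by exact: mulfI e0 _ _ fij.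
apply: (@height_neq y p) => //; [lia|lia|lia|].
by move=> m ms; case/orP: (s_out m ms) => [->//|rm]; apply/orP; right; lia.
Qed.

(** Each use of [sum_block_bridge] drops the condition on the last remaining segment; at [b = 0]
    only the height of the origin is left, which is 0. *)
Lemma sum_bridges x b : affine_general_perm x -> (b <= d)%N ->
  (\prod_(j < b) (nth 0%N s j.+1 - nth 0%N s j)%:R) * \sum_(t : 'S_n)
    (let y := row_perm t x in
     g (increments (walk y) s) * (nonneg_upto y (nth 0%N s b))%:R) =
  \sum_(t : 'S_n) g (increments (walk (row_perm t x)) s).
Proof.
move=> gx; elim: b => [|b IH] bd.
  rewrite big_ord0 mul1r; apply: eq_bigr => t _ /=; rewrite s0.
  suff -> : nonneg_upto (row_perm t x) 0 by rewrite mulr1.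
  by apply/forallP => k; rewrite ord1 walk0 height0 mulr0.
by rewrite big_ord_recr /= -mulrA sum_block_bridge // IH // ltnW.
Qed.

End Rearrangement.

(** * Summation over increasing index tuples *)

Section SumOverIndices.
Context {n d : nat}.

Lemma path_addn (a : nat) (l : seq nat) :
  path ltn a [seq (a + m)%N | m <- l] = path ltn 0 l.
Proof.
rewrite -[X in path _ X _](addn0 a) path_map.
by apply: eq_path => u v /=; rewrite ltn_add2l.
Qed.

(** An increasing tuple corresponds to its first entry [a] together with the differences to [a], the
    largest of which bounds the range of [a]. *)
Lemma sum_sorted_shift (V : nmodType) (F : seq nat -> V) :
  \sum_(i : d.+1.-tuple 'I_n.+1 | sorted ltn (map val i)) F (map val i) =
  \sum_(j : d.-tuple 'I_n.+1 | sorted ltn (0%N :: map val j))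
    \sum_(a < (n - last 0%N (0%N :: map val j)).+1)
      F [seq (a + m)%N | m <- 0%N :: map val j].
Proof.
pose shift (p : d.-tuple 'I_n.+1 * 'I_n.+1) : d.+1.-tuple 'I_n.+1 :=
  [tuple of p.2 :: [seq inord (p.2 + m) | m : 'I_n.+1 <- p.1]].
pose unshift (i : d.+1.-tuple 'I_n.+1) : d.-tuple 'I_n.+1 * 'I_n.+1 :=
  ([tuple of [seq inord (m - thead i) | m : 'I_n.+1 <- behead i]], thead i).
have shiftK (i : d.+1.-tuple 'I_n.+1) :
    sorted ltn (map val i) -> shift (unshift i) = i.
  case/tupleP: i => a r /= ar; apply: val_inj; rewrite /= theadE -map_comp.
  congr (_ :: _); rewrite -[RHS]map_id; apply/eq_in_map => m mr; apply: val_inj.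
  have am : (a < m)%N.
    by move/allP: (order_path_min ltn_trans ar); apply; exact: map_f.
  have ma : (m - a < n.+1)%N by have := ltn_ord m; lia.
  by rewrite /= (inordK ma) subnKC ?inordK // ltnW.
have inordE (a : 'I_n.+1) (l : seq 'I_n.+1) :
    {in l, forall m : 'I_n.+1, a + m <= n}%N ->
    map val [seq inord (a + m) : 'I_n.+1 | m : 'I_n.+1 <- l] =
    [seq (a + m)%N | m <- map val l].
  move=> al; rewrite -!map_comp; apply/eq_in_map => m ml /=.
  by rewrite inordK // ltnS al.
have le_last (a : 'I_n.+1) (l : seq 'I_n.+1) : path ltn 0 (map val l) ->
    (a + last 0%N (map val l) <= n)%N ->
    {in l, forall m : 'I_n.+1, a + m <= n}%N.
  move=> pl al m ml; apply: leq_trans al; rewrite leq_add2l.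
  have /= : (val m \in 0%N :: map val l) by rewrite inE map_f ?orbT.
  move=> /(nthP 0%N)[k kl <-].
  rewrite (last_nth 0%N) size_map.
  apply: (sorted_leq_nth leq_trans leqnn) => //.
  - by apply: (@sub_path _ ltn leq _ _ _ pl) => u v; exact: ltnW.
  - by rewrite inE /= size_map.
  - by rewrite /= size_map in kl.
have last_le (a : 'I_n.+1) (l : seq 'I_n.+1) :
    {in l, forall m : 'I_n.+1, a + m <= n}%N ->
    (a + last 0%N (map val l) <= n)%N.
  case: l => [|m l] al /=; first by rewrite addn0 -ltnS.
  by rewrite (last_map val); apply: al; exact: mem_last.
rewrite (reindex_onto shift unshift) //=.
transitivity (\sum_(j : d.-tuple 'I_n.+1 | sorted ltn (0%N :: map val j))
  \sum_(a < n.+1 | (a < (n - last 0%N (0%N :: map val j)).+1)%N)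
     F [seq (a + m)%N | m <- 0%N :: map val j]); last first.
  apply: eq_bigr => j _; rewrite [RHS](big_ord_widen n.+1
    (fun a : nat => F [seq (a + m)%N | m <- 0%N :: map val j])) //.
  by rewrite ltnS leq_subr.
rewrite pair_big_dep /=.
(* If [a + m] exceeded [n], [inord] would return 0, which cannot follow [a] in an increasing
   sequence. *)
have shift_le (j : d.-tuple 'I_n.+1) (a : 'I_n.+1) :
    path ltn a (map val [seq inord (a + m) : 'I_n.+1 | m : 'I_n.+1 <- j]) ->
    {in j, forall m : 'I_n.+1, a + m <= n}%N.
  move=> /(order_path_min ltn_trans)/allP aj m mj.
  have := aj _ (map_f val (map_f (fun m : 'I_n.+1 => inord (a + m)) mj)).
  rewrite /=; have [//|nam] := leqP (a + m) n.
  by rewrite /inord /insubd insubF // ltnS leqNgt nam.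
apply: eq_big => [[j a]|[j a]] /=; last first.
  by move=> /andP[/shift_le/inordE -> _]; rewrite addn0.
apply/andP/andP => [[aj _]|[j_sorted aL]].
  have ajn := shift_le _ _ aj; rewrite inordE // path_addn in aj.
  have lt_sub u v : (u + v <= n)%N -> (u < (n - v).+1)%N by lia.
  by split=> //; apply: lt_sub; exact: last_le.
have ajn : {in j, forall m : 'I_n.+1, a + m <= n}%N.
  apply: le_last => //.
  have sub_lt u v : (u < n.+1)%N -> (v <= n)%N -> (u < (n - v).+1)%N ->
      (u + v <= n)%N.
    by lia.
  apply: sub_lt => //.
  by apply: (last_le ord0) => m mj; rewrite add0n -ltnS.
rewrite inordE // path_addn; split=> //; apply/eqP; congr (_, _).
  apply: val_inj; rewrite /= -map_comp -[RHS]map_id; apply/eq_in_map => m mj.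
  by rewrite /= theadE (@inordK n (a + m)) ?ltnS ?ajn // addKn inord_val.
Qed.

End SumOverIndices.

Section AverageIdentity.
Context {R : realType} {n d : nat}.

Definition gap_prod (s : seq nat) : R :=
  \prod_(j < d) (nth 0%N s j.+1 - nth 0%N s j)%N%:R.

Lemma gap_prod_gt0 s : size s = d.+1 -> sorted ltn s -> 0 < gap_prod s.
Proof.
move=> ss s_sorted; apply: prodr_gt0 => j _; rewrite ltr0n subn_gt0.
by have jd := ltn_ord j; apply: (sorted_ltn_nth ltn_trans); rewrite ?inE ?ss //; lia.
Qed.

(** Summing over the first index removes the minimum condition, and [sum_bridges] at [b = d] removes
    the bridges at the price of the gap product. *)
Lemma sum_perm_one_side (g : 'M[R]_(d, d.+1) -> R) (e : R) (x : 'M[R]_(n, d.+1)) :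
  e != 0 -> affine_general_perm x ->
  \sum_(i : d.+1.-tuple 'I_n.+1 | sorted ltn (map val i)) \sum_(t : 'S_n)
    (let y := row_perm t x in
     g (increments (walk y) (map val i)) *
       (on_one_side (n := n) e (walk y) (map val i))%:R) =
  \sum_(j : d.-tuple 'I_n.+1 | sorted ltn (0%N :: map val j))
    \sum_(t : 'S_n)
      g (increments (walk (row_perm t x)) (0%N :: map val j)) /
        gap_prod (0%N :: map val j).
Proof.
move=> e0 gx.
rewrite (sum_sorted_shift (fun i => \sum_(t : 'S_n)
    (let y := row_perm t x in
     g (increments (walk y) i) * (on_one_side (n := n) e (walk y) i)%:R))).
apply: eq_bigr => j j_sorted.
set s := 0%N :: map val j.
have ss : size s = d.+1 by rewrite /= size_map size_tuple.
have sn : (last 0%N s <= n)%N.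
  have : last 0%N s \in s by rewrite /s /= mem_last.
  rewrite inE => /predU1P[-> //|/mapP[m _ ->]]; rewrite -ltnS; exact: ltn_ord.
rewrite sum_block_start // -mulr_suml -(sum_bridges _ _ _ _ _ e0 gx (leqnn d)) //.
have -> : nth 0%N s d = last 0%N s by rewrite -nth_last ss.
rewrite mulrAC divff ?mul1r //.
by rewrite gt_eqF // gap_prod_gt0.
Qed.

End AverageIdentity.

(** * Facets of the hull *)

Section ConvexHull.
Context {R : realType} {d : nat}.
Local Notation V := 'rV[R]_d.
Implicit Types (A B : set V) (u : 'cV[R]_d).

Lemma convex_setP A :
  convex_set A <-> forall x y (t : R), A x -> A y -> 0 <= t <= 1 ->
    A (t *: x + (1 - t) *: y).
Proof.
split=> [cA x y t Ax Ay t01|cA x y t].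
  have := @cA x y (Itv01 (proj1 (andP t01)) (proj2 (andP t01))).
  by rewrite !in_setE; apply.
rewrite !in_setE => Ax Ay; apply: (cA x y t%:num) => //.
by apply/andP; split.
Qed.

Lemma convex_hull_convex A : convex_set (convex_hull A).
Proof.
apply/convex_setP => x y t Ax Ay t01 B [cB AB].
by move/convex_setP: (cB); apply => //; [exact: Ax|exact: Ay].
Qed.

Lemma convex_hull_min A B : convex_set B -> A `<=` B -> convex_hull A `<=` B.
Proof. exact: smallest_sub. Qed.

Lemma sub_convex_hull A : A `<=` convex_hull A.
Proof. exact: sub_gen_smallest. Qed.

Lemma convex_hull_pairing A u c :
  (forall x, A x -> pairing x u = c) -> forall x, convex_hull A x -> pairing x u = c.
Proof.
move=> Ac; apply: (convex_hull_min (B := [set x | pairing x u = c])) => //.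
apply/convex_setP => x y t /= xc yc _.
by rewrite pairingD !pairingZ xc yc -mulrDl subrKC mul1r.
Qed.

Lemma convex_hull_vspace A (W : {vspace V}) x0 :
  (forall x, A x -> x - x0 \in W) -> forall x, convex_hull A x -> x - x0 \in W.
Proof.
move=> AW; apply: (convex_hull_min (B := [set x | x - x0 \in W])) => //.
apply/convex_setP => x y t /= xW yW _.
rewrite (_ : _ - x0 = t *: (x - x0) + (1 - t) *: (y - x0)).
  by rewrite memvD // memvZ.
by rewrite !scalerBr addrACA -opprD -scalerDl subrKC scale1r.
Qed.

(* [{x | pairing x u < c} `|` convex_hull (A `&` {x | pairing x u = c})] is
   convex, so it contains the hull of [A]. *)
Lemma face_convex_hull A u c : (forall x, A x -> pairing x u <= c) ->
  [set x | convex_hull A x /\ pairing x u = c] =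
  convex_hull (A `&` [set x | pairing x u = c]).
Proof.
move=> Ac; apply/seteqP; split=> [x [Ax xc]|].
  have eqc : forall y, convex_hull (A `&` [set x | pairing x u = c]) y ->
      pairing y u = c by apply: convex_hull_pairing => y [].
  suff : convex_hull A `<=`
    [set y | pairing y u < c] `|` convex_hull (A `&` [set x | pairing x u = c]).
    by move=> /(_ x Ax)[|//] /=; rewrite xc ltxx.
  apply: convex_hull_min => [|y Ay]; last first.
    have := Ac _ Ay; rewrite le_eqVlt => /predU1P[yc|]; [right|by left].
    by apply: sub_convex_hull; split.
  apply/convex_setP => y z t Hy Hz /andP[t0 t1].
  (* A point strictly below the level is of no help when its weight is 0, so the extreme values of
     [t] are treated first. *)
  have [t00|tn0] := eqVneq t 0; first by rewrite t00 scale0r add0r subr0 scale1r.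
  have [t11|tn1] := eqVneq t 1; first by rewrite t11 subrr scale0r addr0 scale1r.
  have {tn0}t0 : 0 < t by rewrite lt_neqAle eq_sym tn0.
  have {tn1}t1 : 0 < 1 - t by rewrite subr_gt0 lt_neqAle tn1.
  have [[yc|yH] [zc|zH]] := (Hy, Hz).
  - by left; rewrite /= pairingD !pairingZ; rewrite /= in yc zc; nra.
  - by left; rewrite /= pairingD !pairingZ (eqc _ zH); rewrite /= in yc; nra.
  - by left; rewrite /= pairingD !pairingZ (eqc _ yH); rewrite /= in zc; nra.
  right; move/convex_setP: (@convex_hull_convex (A `&` [set x | pairing x u = c])).
  by apply => //; rewrite ltW //= -subr_ge0 ltW.
apply: convex_hull_min => [|x [Ax xc]]; last by split=> //; exact: sub_convex_hull.
apply/convex_setP => x y t /= [Ax xc] [Ay yc] t01; split.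
  by move/convex_setP: (@convex_hull_convex A); apply.
by rewrite pairingD !pairingZ xc yc -mulrDl subrKC mul1r.
Qed.

Lemma convex_hull0 : convex_hull (set0 : set V) = set0.
Proof.
by apply/seteqP; split=> //; apply: convex_hull_min => //; apply/convex_setP.
Qed.

Lemma annihilator (W : {vspace V}) : (\dim W < d)%N ->
  exists2 u : 'cV[R]_d, u != 0 & forall x, x \in W -> pairing x u = 0.
Proof.
move=> Wd; pose A : 'M[R]_(\dim W, d) := \matrix_(j < \dim W) (vbasis W)`_j.
have : kermx A^T != 0.
  rewrite kermx_eq0 /row_free mxrank_tr neq_ltn.
  by rewrite (leq_ltn_trans (rank_leq_row _) Wd).
move=> /rowV0Pn[v /sub_kermxP vA v0]; exists v^T.
  by rewrite -(inj_eq trmx_inj) trmxK trmx0.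
have Av : A *m v^T = 0 by apply: trmx_inj; rewrite trmx_mul trmxK trmx0.
move=> x xW; rewrite (coord_vbasis xW) /pairing mulmx_suml summxE big1 // => j _.
rewrite -scalemxAl mxE -[_`_j](rowK (fun j => (vbasis W)`_j)) -/A -row_mul Av.
by rewrite !mxE mulr0.
Qed.

End ConvexHull.

Section Facets.
Context {R : realType} {d : nat} (n : nat) (S : nat -> 'rV[R]_d.+1).
Hypotheses (dn : (d.+1 <= n)%N) (agS : affine_general n S).
Local Notation V := 'rV[R]_d.+1.
Implicit Types (s : seq nat) (u : 'cV[R]_d.+1) (i : d.+1.-tuple 'I_n.+1).

Definition simplex s : set V := convex_hull [set S k | k in [set k | k \in s]].

Definition is_facet_index s :=
  on_one_side (n := n) 1 S s || on_one_side (n := n) (-1) S s.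

(** There are at least [d.+2] indices, so some point lies off the hyperplane of any simplex; this
    makes one-sidedness strict somewhere. *)
Lemma exists_notin s : size s = d.+1 -> exists2 k, (k <= n)%N & k \notin s.
Proof.
move=> ss; apply: contrapT => nk.
have : (size (iota 0 n.+1) <= size s)%N.
  apply: uniq_leq_size; first exact: iota_uniq.
  move=> k; rewrite mem_iota /= add0n ltnS => kn.
  by apply/negPn/negP => ks; apply: nk; exists k.
by rewrite size_iota ss ltnS leqNgt dn.
Qed.

Lemma walk_hull_vertex k : (k <= n)%N -> walk_hull n S (S k).
Proof. by move=> kn; apply: sub_convex_hull; exists k. Qed.

(** By [face_convex_hull] the face cut out by [u] is the hull of the points on the level [c], and
    these are the ones indexed by [s]. *)
Lemma face_simplex s u c : {in s, forall k, (k <= n)%N /\ pairing (S k) u = c} ->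
  (forall k, (k <= n)%N -> k \notin s -> pairing (S k) u < c) ->
  (forall x, walk_hull n S x -> pairing x u <= c) /\
  simplex s = [set x | walk_hull n S x /\ pairing x u = c].
Proof.
move=> sP snP.
have le_c x : [set S k | k in [set k : nat | (k <= n)%N]] x -> pairing x u <= c.
  move=> [k kn <-]; have [ks|ks] := boolP (k \in s); last exact/ltW/snP.
  by rewrite (sP k ks).2.
split.
  apply: convex_hull_min (le_c); apply/convex_setP => x y t /= xc yc /andP[t0 t1].
  by rewrite pairingD !pairingZ; nra.
rewrite [RHS](face_convex_hull le_c) /simplex; congr convex_hull.
apply/seteqP; split=> [_ [k /= ks <-]|_ [[k kn <-] /= kc]].
  by split; [exists k => //; exact: (sP k ks).1 | exact: (sP k ks).2].
exists k => //=; apply: contrapT => /negP /(snP k kn).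
by rewrite kc ltxx.
Qed.

Lemma is_facet_index_support s : size s = d.+1 -> uniq s ->
  {in s, forall k, (k <= n)%N} -> is_facet_index s ->
  exists u c, [/\ u != 0, {in s, forall k, (k <= n)%N /\ pairing (S k) u = c} &
    (forall k, (k <= n)%N -> k \notin s -> pairing (S k) u < c)].
Proof.
move=> ss us sn sF.
have [e e0 eF] : exists2 e : R, e != 0 & on_one_side (n := n) e S s.
  by case/orP: sF => h; [exists 1|exists (-1)] => //; rewrite ?oppr_eq0 oner_eq0.
(* [on_one_side] bounds the heights from below and a face bounds the functional from above, hence
   the minus sign. *)
pose u := - e *: normal (increments S s).
have pE x : pairing x u = - e * height (increments S s) x.
  by rewrite /pairing /u -scalemxAr mxE.
have neq0 k : (k <= n)%N -> k \notin s ->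
    pairing (S k) u < pairing (S (nth 0%N s 0)) u.
  move=> kn ks; rewrite -subr_lt0 -pairingB pE mulNr oppr_lt0 lt_neqAle eq_sym.
  rewrite mulf_neq0 ?(height_neq0 agS) //=.
  have kn' : (k < n.+1)%N by [].
  exact: (forallP eF (Ordinal kn')).
exists u, (pairing (S (nth 0%N s 0)) u); split=> //.
  have [k kn ks] := exists_notin ss.
  apply/eqP => u0; have := neq0 k kn ks.
  by rewrite u0 /pairing !mulmx0 ltxx.
move=> k ks; split; first exact: sn.
by apply/eqP; rewrite -subr_eq0 -pairingB pE height_node // mulr0.
Qed.

(** The [d] differences to one vertex span the direction space. If its dimension were smaller,
    adding one further point would still leave a proper subspace, and [d.+2] points would share a
    hyperplane. *)
Lemma affine_dim_simplex s : size s = d.+1 -> uniq s ->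
  {in s, forall k, (k <= n)%N} -> has_affine_dim (simplex s) d.
Proof.
move=> ss us sn; set k0 := nth 0%N s 0.
have k0s : k0 \in s by rewrite mem_nth ?ss.
have sE : s = k0 :: behead s by rewrite /k0; case: (s) ss.
pose W : {vspace V} := <<[seq S k - S k0 | k <- behead s]>>%VS.
have sW k : k \in s -> S k - S k0 \in W.
  rewrite sE inE => /predU1P[->|ks]; first by rewrite subrr mem0v.
  by rewrite memv_span //; apply/mapP; exists k.
have sS k : k \in s -> simplex s (S k).
  by move=> ks; apply: sub_convex_hull; exists k.
exists (S k0), W; split=> //; first exact: sS.
- by apply: convex_hull_vspace => _ [k ks <-]; exact: sW.
- move=> U sU; apply/span_subvP => _ /mapP[k ks ->]; apply: sU; apply: sS.
  by rewrite sE inE ks orbT.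
have sz : size [seq S k - S k0 | k <- behead s] = d.
  by rewrite size_map size_behead ss.
apply/eqP; rewrite eqn_leq; apply/andP; split; first by rewrite -[leqRHS]sz dim_span.
rewrite leqNgt; apply/negP => Wd.
have [k kn ks] := exists_notin ss.
have : (\dim (W + <[S k - S k0]>)%VS < d.+1)%N.
  apply: leq_ltn_trans (dimv_add_leqif _ _).1 _.
  rewrite dim_vline; have := leq_b1 (S k - S k0 != 0); lia.
move=> /annihilator[u u0 Wu].
suff : (size (k :: s) <= d.+1)%N by rewrite /= ss ltnn.
apply: (@affine_general_size _ _ _ _ agS u (pairing (S k0) u)) => //=.
  by rewrite ks.
have Sm m : S m - S k0 \in (W + <[S k - S k0]>)%VS ->
    pairing (S m) u = pairing (S k0) u.
  by move=> /Wu; rewrite pairingB => /eqP; rewrite subr_eq0 => /eqP.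
move=> m; rewrite inE => /predU1P[->|ms]; (split; first by [|exact: sn]); apply: Sm.
- by rewrite (subvP (addvSr _ _)) // memv_line.
- by rewrite (subvP (addvSl _ _)) // sW.
Qed.

Lemma facet_simplex s : size s = d.+1 -> uniq s ->
  {in s, forall k, (k <= n)%N} -> is_facet_index s ->
  facets (walk_hull n S) (simplex s).
Proof.
move=> ss us sn sF; split; last exact: affine_dim_simplex.
have [u [c [_ sc snc]]] := is_facet_index_support ss us sn sF.
by exists u, c; exact: face_simplex.
Qed.

(** The functional supporting [s] attains its maximum over the points at the indices of [s] only, so
    vertices of the same simplex have indices in [s]. Only [s] is a facet index, because [s'] will
    be any candidate for [facet_indices]. *)
Lemma simplex_inj s s' : size s = d.+1 -> sorted ltn s -> 
  size s' = d.+1 -> sorted ltn s' -> {in s, forall k, (k <= n)%N} ->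
  {in s', forall k, (k <= n)%N} ->
  is_facet_index s -> simplex s = simplex s' -> s' = s.
Proof.
move=> ss us ss' us' sn sn' sF sE.
have uniq_s r : sorted ltn r -> uniq r by exact: sorted_uniq ltn_trans ltnn _.
have [u [c [_ sc snc]]] := is_facet_index_support ss (uniq_s _ us) sn sF.
apply: (sorted_eq ltn_trans) => //.
  by move=> a b /andP[ab ba]; lia.
rewrite uniq_perm ?uniq_s //.
have sub : {subset s' <= s}.
  move=> k ks'; apply/negPn/negP => ks; have := snc k (sn' k ks') ks.
  suff -> : pairing (S k) u = c by rewrite ltxx.
  have : simplex s' (S k) by apply: sub_convex_hull; exists k.
  by rewrite -sE (face_simplex sc snc).2 => -[].
by have [] := uniq_min_size (uniq_s _ us') sub (eq_leq (etrans ss (esym ss'))).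
Qed.

(** Excludes the face given by [u = 0], the hull itself: its [n.+1] vertices are too many for one
    hyperplane. *)
Lemma walk_hull_dim_neq F (V : {vspace 'rV[R]_d.+1}) x0 : walk_hull n S = F ->
  (forall x, F x -> x - x0 \in V) -> \dim V != d.
Proof.
move=> <- FV; apply/eqP => dimV.
have [|u u0 uV] := @annihilator _ _ V; first by rewrite dimV.
suff : (size (iota 0 n.+1) <= d.+1)%N by rewrite size_iota ltnS leqNgt dn.
apply: (@affine_general_size _ _ _ _ agS u (pairing x0 u)) => //.
  exact: iota_uniq.
move=> k; rewrite mem_iota add0n ltnS => /= kn; split=> //.
have := uV _ (FV _ (walk_hull_vertex kn)).
by rewrite pairingB => /eqP; rewrite subr_eq0 => /eqP.
Qed.

(** The indices are those where the supporting functional attains its maximum [c]. The dimension of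
    the facet gives at least [d.+1] of them and general position at most as many. *)
Lemma facet_index F : facets (walk_hull n S) F ->
  exists s, [/\ size s = d.+1, sorted ltn s, {in s, forall k, (k <= n)%N},
    is_facet_index s & F = simplex s].
Proof.
move=> [[u [c [hc FE]]] [x0 [V [Fx0 FV Vmin dimV]]]].
pose s := [seq k <- iota 0 n.+1 | pairing (S k) u == c].
have sn : {in s, forall k, (k <= n)%N}.
  by move=> k; rewrite mem_filter mem_iota add0n ltnS => /andP[_ /andP[]].
have mem_s k : (k \in s) = (pairing (S k) u == c) && (k <= n)%N.
  by rewrite mem_filter mem_iota add0n ltnS.
have s_sorted : sorted ltn s.
  by apply: (sorted_filter ltn_trans); exact: iota_ltn_sorted.
have FsE : F = simplex s.
  rewrite FE (face_convex_hull (A := [set S k | k in [set k | (k <= n)%N]]));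
    last first.
    by move=> _ [k kn <-]; apply: hc; exact: walk_hull_vertex.
  congr convex_hull; apply/seteqP; split=> [_ [[k kn <-] /= kc]|_ [k /= ks <-]].
    by exists k => //=; rewrite mem_s kn andbT; exact/eqP.
  move: ks; rewrite mem_s => /andP[/eqP kc kn].
  by split=> //; exists k.
exists s.
have [s0|s0] := eqVneq s [::].
  move: Fx0; rewrite FsE /simplex s0 (_ : [set S k | k in _] = set0) ?convex_hull0 //.
  by apply/seteqP; split=> // y [].
set k0 := nth 0%N s 0.
have sE : s = k0 :: behead s by rewrite /k0; case: (s) s0.
have k0s : k0 \in s by rewrite sE mem_head.
pose W : {vspace 'rV[R]_d.+1} := <<[seq S k - S k0 | k <- behead s]>>%VS.
have sW k : k \in s -> S k - S k0 \in W.
  rewrite sE inE => /predU1P[->|ks]; first by rewrite subrr mem0v.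
  by rewrite memv_span //; apply/mapP; exists k.
have FW x : F x -> x - S k0 \in W.
  rewrite FsE; apply: convex_hull_vspace => _ [k ks <-]; exact: sW.
have ds : (d < size s)%N.
  have /Vmin/dimvS : forall x, F x -> x - x0 \in W.
    move=> x Fx; have -> : x - x0 = (x - S k0) - (x0 - S k0) by rewrite opprB subrKA.
    by rewrite memvB ?FW.
  rewrite dimV => /leq_trans/(_ (dim_span _)).
  by rewrite size_map size_behead; move: s0; case: (s).
have u0 : u != 0.
  apply/eqP => u0; have c0 : c = 0.
    by move: Fx0; rewrite FE u0 => -[_]; rewrite mulmx0 mxE => ->.
  have /walk_hull_dim_neq/(_ FV)/eqP : walk_hull n S = F; last by apply.
  rewrite FE; apply/seteqP; split=> [x Cx|x []//].
  by split=> //; rewrite u0 c0 mulmx0 mxE.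
have us : uniq s by exact: sorted_uniq ltn_trans ltnn _ s_sorted.
have ss : size s = d.+1.
  apply/eqP; rewrite eqn_leq ds andbT.
  apply: (@affine_general_size _ _ _ _ agS u c) => // k.
  by rewrite mem_s => /andP[/eqP].
split=> //.
have [k1 k1n k1s] := exists_notin ss.
pose h k := height (increments S s) (S k - S k0).
pose p k := pairing (S k - S k0) u.
have p_le0 k : (k <= n)%N -> p k <= 0.
  move=> kn; rewrite /p pairingB subr_le0.
  move: k0s; rewrite mem_s => /andP[/eqP -> _].
  by apply: hc; exact: walk_hull_vertex.
have p1 : p k1 != 0.
  apply: contra k1s; rewrite /p pairingB subr_eq0 mem_s k1n andbT => /eqP ->.
  by move: k0s; rewrite mem_s => /andP[].
(* [t] is fixed by agreement at [k1]. The normal minus [t *: u] is then constant on the [d.+2]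
   points of [k1 :: s], so it is zero. *)
pose t := h k1 / p k1.
have hE k : h k = t * p k.
  apply/eqP; rewrite -subr_eq0.
  pose v := normal (increments S s) - t *: u.
  have vE x : pairing x v = height (increments S s) x - t * pairing x u.
    by rewrite /height /pairing /v mulmxBr -scalemxAr !mxE.
  rewrite -vE; have [-> |v0] := eqVneq v 0; first by rewrite /pairing mulmx0 mxE.
  suff : (size (k1 :: s) <= d.+1)%N by rewrite /= ss ltnn.
  apply: (@affine_general_size _ _ _ _ agS v (pairing (S k0) v)) => //=.
    by rewrite k1s.
  move=> m; rewrite inE => /predU1P[->|ms].
    split=> //; apply/eqP; rewrite -subr_eq0 -pairingB vE.
    by rewrite -/(h k1) -/(p k1) /t divfK // subrr.
  split; first exact: sn.
  apply/eqP; rewrite -subr_eq0 -pairingB vE height_node // pairingB.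
  move: ms k0s; rewrite !mem_s => /andP[/eqP -> _] /andP[/eqP -> _].
  by rewrite subrr mulr0 subrr.
(* As [p] is nonpositive on all indices, the sign of [t] decides the side. *)
rewrite /is_facet_index; have [t0|t0] := leP 0 t; apply/orP; [right|left].
  apply/forallP => k; rewrite -/k0 -/(h k) hE mulN1r oppr_ge0.
  by rewrite mulr_ge0_le0 // p_le0 // -ltnS.
apply/forallP => k; rewrite -/k0 -/(h k) hE mul1r mulr_le0 ?(ltW t0) //.
by rewrite p_le0 // -ltnS.
Qed.

(** Both sides at once would force every point into the hyperplane. Facets can therefore be counted
    by two separate one-sided sums. *)
Lemma is_facet_indexE s : size s = d.+1 -> uniq s ->
  {in s, forall k, (k <= n)%N} ->
  is_facet_index s =
  (on_one_side (n := n) 1 S s + on_one_side (n := n) (-1) S s)%N :> nat.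
Proof.
move=> ss us sn; rewrite /is_facet_index.
suff : ~~ (on_one_side (n := n) 1 S s && on_one_side (n := n) (-1) S s).
  by do 2 case: on_one_side.
apply/negP => /andP[/forallP h1 /forallP h2].
have [k kn ks] := exists_notin ss.
have /eqP := height_neq0 agS ss us sn kn ks; apply.
have kn' : (k < n.+1)%N by [].
have := h1 (Ordinal kn'); have := h2 (Ordinal kn') => /=.
by rewrite mulN1r mul1r oppr_ge0 => h h'; apply/le_anti; rewrite h.
Qed.

(** [simplex] is a bijection from the increasing tuples that are facet indices onto the facets. *)
Lemma facet_sumE (g : 'M[R]_(d, d.+1) -> R) :
  @facet_sum R d.+1 n g S =
  \sum_(i : d.+1.-tuple 'I_n.+1 | sorted ltn (map val i))
    (g (increments S (map val i)) * (on_one_side (n := n) 1 S (map val i))%:R +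
     g (increments S (map val i)) * (on_one_side (n := n) (-1) S (map val i))%:R).
Proof.
pose P := [pred i : d.+1.-tuple 'I_n.+1 |
  sorted ltn (map val i) && is_facet_index (map val i)].
pose h (i : d.+1.-tuple 'I_n.+1) := simplex (map val i).
have szi (i : d.+1.-tuple 'I_n.+1) : size (map val i) = d.+1.
  by rewrite size_map size_tuple.
have ni (i : d.+1.-tuple 'I_n.+1) : {in map val i, forall k, (k <= n)%N}.
  by move=> k /mapP[m _ ->]; rewrite -ltnS; exact: ltn_ord.
have uniq_s r : sorted ltn r -> uniq r by exact: sorted_uniq ltn_trans ltnn _.
have hE i : h i = convex_hull [set S (val k) | k in [set k : 'I_n.+1 | k \in i]].
  rewrite /h /simplex; congr convex_hull; apply/seteqP; split=> [_ [k /= + <-]|].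
    by move=> /mapP[m mi ->]; exists m.
  by move=> _ [k /= ki <-]; exists (val k) => //=; exact: map_f.
have h_inj i i' : P i -> sorted ltn (map val i') -> h i = h i' -> i' = i.
  move=> /andP[si fi] si' ii'; apply/val_inj/(inj_map val_inj).
  exact: (simplex_inj (szi i) si (szi i') si' (ni i) (ni i') fi).
have hP : set_bij [set` P] (facets (walk_hull n S)) h.
  split.
  - by move=> i /andP[si fi]; exact: (facet_simplex (szi i) (uniq_s _ si) (ni i) fi).
  - move=> i i'; rewrite !in_setE => /andP[si _] Pi' /esym.
    exact: h_inj Pi' si.
  move=> F /facet_index[s [ss s_sorted sn fs ->]].
  have sz : size [seq inord k : 'I_n.+1 | k <- s] == d.+1 by rewrite size_map ss.
  have vs : map val (Tuple sz) = s.
    rewrite /= -map_comp -[RHS]map_id; apply/eq_in_map => k ks /=.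
    by rewrite inordK // ltnS sn.
  by exists (Tuple sz); rewrite /h /= ?vs //; apply/andP; rewrite vs.
rewrite /facet_sum (reindex_fsbig h [set` P]) //.
transitivity (\sum_(i \in [set` P]) g (increments S (map val i))).
  apply: eq_fsbigr => i; rewrite in_setE => Pi.
  (* No other increasing tuple has the same hull, so the choice in [facet_indices] is forced and its
     default does not occur. *)
  suff -> : facet_indices n S (h i) = i by [].
  apply: xget_unique; first by split; [case/andP: Pi|exact: hE].
  by move=> i' [si' hi']; apply: (h_inj _ _ Pi si'); rewrite hi' hE.
rewrite -(@bigfs _ _ _ _ (index_enum (d.+1.-tuple 'I_n.+1)) P)
  ?index_enum_uniq //; last first.
  by move=> i _; rewrite mem_index_enum.
rewrite big_mkcondr; apply: eq_bigr => i si.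
rewrite -mulrDr -natrD -(is_facet_indexE (szi i) (uniq_s _ si) (ni i)).
by case: is_facet_index; rewrite ?mulr1 ?mulr0.
Qed.

End Facets.

(** * Measurability *)

Section BorelMatrix.
Context {dU : measure_display} {U : measurableType dU} {R : realType}.

Lemma measurable_entry (m n : nat) (i : 'I_m) (j : 'I_n) :
  measurable_fun [set: borel 'M[R]_(m, n)]
    (fun x : borel 'M[R]_(m, n) => (x : 'M[R]_(m, n)) i j).
Proof.
apply: (measurability _ (RGenOpens.measurableE R)).
move=> _ [_ [a [b ->] <-]]; rewrite setTI; apply: sub_sigma_algebra.
have /continuousP : continuous (fun M : 'M[R]_(m, n) => M i j).
  by move=> x; exact: coord_continuous.
by apply; exact: interval_open.
Qed.

(** Second countability in explicit form: balls with rational centres and radii [1/(k+1)]. *)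
Lemma mx_open_bigcup (m n : nat) (A : set 'M[R]_(m, n)) : open A ->
  A = \bigcup_(p in [set p : 'M[rat]_(m, n) * nat |
        ball (map_mx ratr p.1 : 'M[R]_(m, n)) p.2.+1%:R^-1 `<=` A])
      ball (map_mx ratr p.1 : 'M[R]_(m, n)) p.2.+1%:R^-1.
Proof.
move=> oA; apply/seteqP; split=> [x Ax|x [p pA /pA]//].
have /nbhs_ballP[e /= e0 eA] : nbhs x A by exact: open_nbhs_nbhs.
(* A centre within [1/(k+1)] of [x] has its ball of that radius inside the ball of radius [2/(k+1)]
   around [x], hence the 2. *)
pose k := Num.trunc (2 / e).
have ke : 2 * k.+1%:R^-1 <= e.
  rewrite ler_pdivrMr // mulrC -ler_pdivrMr //.
  exact/ltW/truncnS_gt.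
have /all_sig[q qP] (ij : 'I_m * 'I_n) :
    {r : rat | ball (x ij.1 ij.2) k.+1%:R^-1 (ratr r)}.
  apply: cid.
  have [|r] := @rat_in_itvoo R (x ij.1 ij.2) (x ij.1 ij.2 + k.+1%:R^-1).
    by rewrite ltrDl invr_gt0.
  rewrite in_itv /= => /andP[r1 r2]; exists r.
  by rewrite /ball /= distrC ger0_norm ?subr_ge0 ?ltW // ltrBlDl.
have xq : ball x k.+1%:R^-1 (map_mx ratr (\matrix_(i, j) q (i, j)) : 'M[R]_(m, n)).
  by split=> [|i j]; rewrite ?invr_gt0 // !mxE; exact: qP (i, j).
exists (\matrix_(i, j) q (i, j), k) => /=; last exact: ball_sym.
move=> y qy; apply: eA; apply: (le_ball ke).
by rewrite mulr_natl mulr2n; exact: ball_triangle xq qy.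
Qed.

(** Open sets are countable unions of balls, and a ball of matrices is a finite intersection of
    conditions on single entries. *)
Lemma measurable_borel_matrix (m n : nat) (f : U -> 'M[R]_(m, n)) :
  (forall i j, measurable_fun [set: U] (fun w => f w i j)) ->
  measurable_fun [set: U] (f : U -> borel 'M[R]_(m, n)).
Proof.
move=> mf.
apply: (@measurability _ _ _ (borel 'M[R]_(m, n)) _ _ (@open 'M[R]_(m, n))) => //.
move=> _ [A oA <-]; rewrite setTI (mx_open_bigcup oA) preimage_bigcup.
rewrite bigcup_mkcond; apply: countable_bigcupT_measurable => // -[q k].
case: ifP => // _.
rewrite (_ : _ @^-1` _ = \bigcap_(ij in [set: 'I_m * 'I_n])
    (fun w => f w ij.1 ij.2) @^-1` ball (ratr (q ij.1 ij.2) : R) k.+1%:R^-1).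
  apply: fin_bigcap_measurable => // ij _.
  rewrite -[_ @^-1` _]setTI; apply: mf => //.
  by apply: open_measurable; apply: ball_open.
apply/seteqP; split=> [w [_ /= wq] [i j] _|w wq]; first by have := wq i j; rewrite mxE.
by split; rewrite ?invr_gt0 // => i j; rewrite mxE; exact: wq (i, j) _.
Qed.

End BorelMatrix.

Section EntrywiseMeasurable.
Context {dU : measure_display} {U : measurableType dU} {R : realType}.

Definition mx_measurable (m n : nat) (f : U -> 'M[R]_(m, n)) :=
  forall i j, measurable_fun [set: U] (fun w => f w i j).

Lemma mx_measurableB (m n : nat) (f h : U -> 'M[R]_(m, n)) :
  mx_measurable f -> mx_measurable h -> mx_measurable (fun w => f w - h w).
Proof.
move=> mf mh i j; under eq_fun do rewrite !mxE.
by apply: measurable_funB; [exact: mf|exact: mh].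
Qed.

Lemma mx_measurableM (m n p : nat) (f : U -> 'M[R]_(m, n)) (h : U -> 'M[R]_(n, p)) :
  mx_measurable f -> mx_measurable h -> mx_measurable (fun w => f w *m h w).
Proof.
move=> mf mh i j; under eq_fun do rewrite mxE.
by apply: measurable_sum => k; apply: measurable_funM; [exact: mf|exact: mh].
Qed.

Lemma mx_measurable_det (n : nat) (f : U -> 'M[R]_n) :
  mx_measurable f -> measurable_fun [set: U] (fun w => \det (f w)).
Proof.
move=> mf; rewrite /determinant; apply: measurable_sum => s.
apply: measurable_funM; first exact: measurable_cst.
by apply: measurable_prod => i _; exact: mf.
Qed.

Lemma mx_measurable_normal (d : nat) (f : U -> 'M[R]_(d, d.+1)) :
  mx_measurable f -> mx_measurable (fun w => normal (f w)).
Proof.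
move=> mf i j; under eq_fun do rewrite !mxE.
apply: measurable_funM; first exact: measurable_cst.
apply: mx_measurable_det => k l; under eq_fun do rewrite !mxE.
case: splitP => k' _; last exact: mf.
by under eq_fun do rewrite mxE; exact: measurable_cst.
Qed.

Lemma mx_measurable_walk (n d : nat) (f : U -> 'M[R]_(n, d)) k :
  mx_measurable f -> mx_measurable (fun w => walk (f w) k).
Proof.
move=> mf i j; under eq_fun do rewrite /walk summxE big_mkcond.
apply: measurable_sum => l; case: (l < k)%N; last exact: measurable_cst.
by under eq_fun do rewrite mxE; exact: mf.
Qed.

Lemma mx_measurable_increments (n d : nat) (f : U -> 'M[R]_(n, d)) s :
  mx_measurable f -> mx_measurable (fun w => increments (walk (f w)) s).
Proof.
move=> mf i j; under eq_fun do rewrite mxE.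
by apply: (mx_measurableB (mx_measurable_walk _ mf) (mx_measurable_walk _ mf)).
Qed.

Lemma mx_measurable_row_perm (n d : nat) (f : U -> 'M[R]_(n, d)) t :
  mx_measurable f -> mx_measurable (fun w => row_perm t (f w)).
Proof. by move=> mf i j; under eq_fun do rewrite mxE; exact: mf. Qed.

Lemma measurable_increments_comp (n d : nat) (f : U -> 'M[R]_(n, d))
    (g : 'M[R]_(d.-1, d) -> R) s : 
  measurable_fun [set: borel 'M[R]_(d.-1, d)] (g : borel 'M[R]_(d.-1, d) -> R) ->
  mx_measurable f ->
  measurable_fun [set: U] (fun w => g (increments (walk (f w)) s)).
Proof.
move=> mg mf; apply: (measurableT_comp mg).
exact/measurable_borel_matrix/mx_measurable_increments.
Qed.

Lemma measurable_on_one_side (n d : nat) (f : U -> 'M[R]_(n, d.+1)) e s :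
  mx_measurable f -> measurable_fun [set: U]
    (fun w => (on_one_side (n := n) e (walk (f w)) s)%:R : R).
Proof.
move=> mf; rewrite (_ : (fun w => _) = fun w => \prod_(k < n.+1)
   if 0 <= e * height (increments (walk (f w)) s)
                      (walk (f w) k - walk (f w) (nth 0%N s 0)) then 1 else 0).
  apply: measurable_prod => k _; apply: measurable_fun_ifT; last 2 first.
  - exact: measurable_cst.
  - exact: measurable_cst.
  apply: measurable_fun_ler; first exact: measurable_cst.
  apply: measurable_funM; first exact: measurable_cst.
  apply: mx_measurableM; first by apply: mx_measurableB; exact: mx_measurable_walk.
  exact/mx_measurable_normal/mx_measurable_increments.
apply/funext => w; rewrite /on_one_side; case: forallP => [h|/existsNP[k /negP kn]].
  by rewrite big1 // => k _; rewrite h.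
by rewrite (bigD1 k) //= (negbTE kn) mul0r.
Qed.

End EntrywiseMeasurable.

(** * From linear to affine general position *)

Section GeneralPosition.
Context {R : realType} {n d : nat}.
Implicit Types (S : nat -> 'rV[R]_d.+1).

Definition sample S (I : {set 'I_n}) : 'M[R]_d.+1 :=
  \matrix_(r < d.+1) [seq S i.+1 | i : 'I_n <- enum I]`_r.

(** General position through determinants, a form in which it is a Borel condition on the steps. *)
Definition nonsingular_samples S :=
  forall I : {set 'I_n}, #|I| = d.+1 -> \det (sample S I) != 0.

Lemma general_position_nonsingular S :
  general_position n S -> nonsingular_samples S.
Proof.
move=> gS I cI; have sz : size [seq S i.+1 | i : 'I_n <- enum I] == d.+1.
  by rewrite size_map -cardE cI.
have /freeP fI : free (Tuple sz) by exact: gS.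
apply/det0P => -[v /eqP v0 vS]; apply: v0; apply/rowP => r; rewrite mxE.
apply: (fI (fun r => v 0 r)); rewrite -[RHS]vS mulmx_sum_row.
by apply: eq_bigr => k _; rewrite rowK.
Qed.

(** With [d.+1] of the points after [S 0] in the linear hyperplane of [u], an invertible sample
    matrix would annihilate [u]. Index 0 adds at most one to the remaining [d]. *)
Lemma nonsingular_level S (u : 'cV[R]_d.+1) : nonsingular_samples S -> u != 0 ->
  (#|[pred k : 'I_n.+1 | (S k *m u) 0%R 0%R == 0%R]| <= d.+1)%N.
Proof.
move=> nS u0; set A := [pred k | _].
have -> : #|A| = (A ord0 + #|[pred i : 'I_n | A (lift ord0 i)]|)%N.
  by rewrite -!sum1_card !big_mkcond big_ord_recl /= -big_mkcond.
suff : (#|[pred i : 'I_n | A (lift ord0 i)]| < d.+1)%N.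
  by have := leq_b1 (A ord0); lia.
rewrite ltnNge; apply/negP => dA.
pose J := [set i : 'I_n | A (lift ord0 i)]%SET.
have : (d.+1 <= #|J|)%N by rewrite cardsE.
move=> /card_geqP[s [us ss sJ]].
have cI : #|[set i in s]%SET| = d.+1 by rewrite cardsE (card_uniqP us).
move/eqP: u0; apply.
have uI : sample S [set i in s]%SET *m u = 0.
  apply/row_matrixP => r; rewrite row_mul rowK row0.
  set e := enum _; have re : (r < size e)%N by rewrite -cardE cI.
  have i0 : 'I_n by case: (e) re => [//|i].
  rewrite (nth_map i0) //.
  have : nth i0 e r \in e by exact: mem_nth.
  rewrite mem_enum inE => /sJ; rewrite inE /A /= => /eqP iu.
  by apply/matrixP => a b; rewrite !ord1 [RHS]mxE -[RHS]iu.
have := nS _ cI; rewrite -unitfE -unitmxE => /mulKmx/(_ u).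
by rewrite uI mulmx0.
Qed.

(** Let [a] be the first index on the hyperplane. Moving the first [a] steps to the end sends each
    index [k] on it to [k - a], where the new walk lies in the parallel linear hyperplane, and
    [nonsingular_level] applies. *)
Lemma nonsingular_affine_general (x : 'M[R]_(n, d.+1)) :
  (forall t : 'S_n, nonsingular_samples (walk (row_perm t x))) ->
  affine_general n (walk x).
Proof.
move=> nx u c u0; set A := [pred k | _].
have [a0 a0A|A0] := pickP A; last first.
  by rewrite (eq_card0 (A := A)).
case: (arg_minnP (fun k : 'I_n.+1 => val k) a0A) => a aA a_min.
have an : (a <= n)%N by rewrite -ltnS.
have yE t : (t <= n - a)%N ->
    walk (row_perm (block_swap (leq0n a) an (leqnn n)) x) t =
    walk x (a + t) - walk x a.
  move=> tn; have := walk_block_swap_fst (leq0n a) an (leqnn n) x tn.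
  by rewrite walk0 add0n add0r.
apply: leq_trans (nonsingular_level (nx (block_swap (leq0n a) an (leqnn n))) u0).
pose f (k : 'I_n.+1) : 'I_n.+1 := inord (k - a).
rewrite -(@card_in_image _ _ f) => [|k l kA lA /(congr1 val) /=]; last first.
  rewrite /f !inordK; first last.
  - exact: leq_ltn_trans (leq_subr _ _) (ltn_ord _).
  - exact: leq_ltn_trans (leq_subr _ _) (ltn_ord _).
  have /= ka := a_min _ kA; have /= la := a_min _ lA.
  by move=> kl; apply/val_inj => /=; lia.
apply/subset_leq_card/fintype.subsetP => _ /fintype.imageP[k kA ->].
have ak := a_min _ kA; have kn := ltn_ord k.
rewrite inE /f inordK; last by lia.
rewrite yE; last by lia.
rewrite subnKC // -[X in X == 0]/(pairing _ u) pairingB subr_eq0.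
by move: kA aA => /eqP kc /eqP ac; rewrite /pairing kc ac.
Qed.

Lemma nonsingular_affine_general_perm (x : 'M[R]_(n, d.+1)) :
  (forall t : 'S_n, nonsingular_samples (walk (row_perm t x))) ->
  affine_general_perm x.
Proof.
by move=> nx t; apply: nonsingular_affine_general => t'; rewrite -row_permM.
Qed.

End GeneralPosition.

Section MeasurableNonsingular.
Context {R : realType} {n d : nat}.

Lemma measurable_nonsingular :
  measurable ([set x | nonsingular_samples (n := n) (walk x)] :
    set (borel 'M[R]_(n, d.+1))).
Proof.
rewrite (_ : [set _ | _] = \bigcap_(I in [set I : {set 'I_n} | #|I| = d.+1])
  (fun x : borel 'M[R]_(n, d.+1) => \det (sample (walk x) I)) @^-1` ~` [set 0]);
  last first.
  apply/seteqP; split=> x /= xI I cI; first by apply/eqP; exact: xI.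
  by apply/eqP; exact: xI.
apply: fin_bigcap_measurable; first exact: finite_finset.
move=> I _; rewrite -[_ @^-1` _]setTI.
suff : measurable_fun [set: borel 'M[R]_(n, d.+1)]
    (fun x : borel 'M[R]_(n, d.+1) => \det (sample (walk x) I)).
  by apply => //; apply: measurableC; exact: measurable_set1.
apply: mx_measurable_det => r j; under eq_fun do rewrite mxE.
elim: (enum I) (r : nat) => [|i e IH] [|k] /=.
- by under eq_fun do rewrite mxE; exact: measurable_cst.
- by under eq_fun do rewrite mxE; exact: measurable_cst.
- apply: mx_measurable_walk => a b; exact: measurable_entry.
- exact: IH.
Qed.

End MeasurableNonsingular.

(** * Exchangeability and expectations *)

Section LowerIntegral.
Context {dT : measure_display} {T : measurableType dT} {R : realType}.
Variable mu : {measure set T -> \bar R}.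
Local Open Scope ereal_scope.

(* Unlike [ge0_le_integral], this does not ask for measurability: the integral
   of a nonnegative function is a supremum over simple functions below it. *)
Lemma ge0_le_lower_integral (f h : T -> \bar R) : (forall w, 0 <= f w) ->
  (forall w, f w <= h w) -> \int[mu]_w f w <= \int[mu]_w h w.
Proof.
move=> f0 fh; have h0 w : 0 <= h w by exact: le_trans (fh w).
rewrite !ge0_integralTE //; apply: le_ereal_sup => _ [s sf <-].
by exists s => // w; exact: le_trans (sf w) (fh w).
Qed.

(** [f] need not be measurable, as for the facet sum. It is squeezed between the modifications of
    [h] on a null set by 0 and by [+oo], which have the integral of [h]. *)
Lemma ae_eq_lower_integral (f h : T -> \bar R) : (forall w, 0 <= f w) ->
  (forall w, 0 <= h w) -> measurable_fun [set: T] h ->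
  {ae mu, forall w, f w = h w} -> \int[mu]_w f w = \int[mu]_w h w.
Proof.
move=> f0 h0 mh [N [mN N0 fhN]].
have fh w : ~ N w -> f w = h w by move=> nN; apply: contrapT => /fhN.
have mif c : measurable_fun [set: T] (fun w => if w \in N then c else h w).
  apply: measurable_fun_ifT => //.
  by apply: (measurable_fun_bool true); rewrite setTI preimage_mem_true.
have eq_h c : 0 <= c -> \int[mu]_w (if w \in N then c else h w) = \int[mu]_w h w.
  move=> c0; apply: ge0_ae_eq_integral => //.
    by move=> w _; case: ifP.
  exists N; split => // w /=; apply: contra_notP => nN _.
  by rewrite memNset.
apply/le_anti/andP; split.
  rewrite -(eq_h +oo) //; apply: ge0_le_lower_integral => // w.
  case: ifPn => [_|]; first exact: leey.
  by move=> /negP; rewrite in_setE => /fh ->.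
rewrite -(eq_h 0) //; apply: ge0_le_lower_integral => w; case: ifPn => // nN.
by rewrite fh // => Nw; rewrite mem_set in nN.
Qed.

End LowerIntegral.

Section Exchangeable.
Context {dT : measure_display} {T : measurableType dT} {R : realType}.
Variables (P : probability T R) (n d : nat) (X : 'I_n -> T -> 'rV[R]_d).
Hypotheses (mX : forall i, measurable_fun [set: T] (X i : T -> borel 'rV[R]_d))
  (exchX : exchangeable P X).

Definition steps (w : T) : 'M[R]_(n, d) := \matrix_(i < n) X i w.

Lemma walk_steps w : walk (steps w) = fun k => partial_sum X k w.
Proof.
by apply/funext => k; rewrite /walk; apply: eq_bigr => i _; rewrite rowK.
Qed.

Lemma row_perm_steps (t : 'S_n) w : row_perm t (steps w) = \matrix_(i < n) X (t i) w.
Proof. by apply/matrixP => i j; rewrite !mxE. Qed.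

Lemma mx_measurable_steps : mx_measurable steps.
Proof.
move=> i j; under eq_fun do rewrite mxE.
exact: (measurableT_comp (measurable_entry _ _)).
Qed.

Lemma measurable_row_perm_steps t :
  measurable_fun [set: T] (fun w => row_perm t (steps w) : borel 'M[R]_(n, d)).
Proof.
exact/measurable_borel_matrix/mx_measurable_row_perm/mx_measurable_steps.
Qed.

Lemma measurable_steps :
  measurable_fun [set: T] (steps : T -> borel 'M[R]_(n, d)).
Proof. exact/measurable_borel_matrix/mx_measurable_steps. Qed.

Lemma exchangeable_pushforward t (B : set (borel 'M[R]_(n, d))) : measurable B ->
  P ((fun w => row_perm t (steps w)) @^-1` B) = P (steps @^-1` B).
Proof.
move=> mB; have := exchX t mB; rewrite /pushforward => <-; congr (P (_ @^-1` B)).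
by apply/funext => w; rewrite row_perm_steps.
Qed.

Local Open Scope ereal_scope.

Lemma integral_row_perm (h : borel 'M[R]_(n, d) -> \bar R) t :
  measurable_fun [set: borel 'M[R]_(n, d)] h -> (forall x, 0 <= h x) ->
  \int[P]_w h (row_perm t (steps w)) = \int[P]_w h (steps w).
Proof.
move=> mh h0.
have := ge0_integral_pushforward (measurable_row_perm_steps t) P measurableT mh
  (fun x _ => h0 x).
rewrite preimage_setT => <-.
have := ge0_integral_pushforward measurable_steps P measurableT mh
  (fun x _ => h0 x).
rewrite preimage_setT => <-.
apply: eq_measure_integral.
- exact: measurable_steps.
- exact: measurable_row_perm_steps.
- by move=> m1 m2 B mB _; exact: exchangeable_pushforward.
Qed.

(** By exchangeability the [n!] terms of the average have equal integrals. *)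
Lemma integral_average (h : borel 'M[R]_(n, d) -> R) :
  measurable_fun [set: borel 'M[R]_(n, d)] h -> (forall x, 0 <= h x)%R ->
  \int[P]_w (h (steps w))%:E =
  \int[P]_w (n`!%:R^-1 * \sum_(t : 'S_n) h (row_perm t (steps w)))%:E.
Proof.
move=> mh h0.
have mht t : measurable_fun [set: T] (fun w => (h (row_perm t (steps w)))%:E).
  by apply/measurable_EFinP; exact: (measurableT_comp mh (measurable_row_perm_steps t)).
under [RHS]eq_integral do rewrite EFinM -sumEFin.
rewrite ge0_integralZl_EFin //; last 2 first.
- by move=> w _; apply: sume_ge0 => t _; rewrite lee_fin.
- exact: emeasurable_sum.
rewrite ge0_integral_sum //; last by move=> t w _; rewrite lee_fin.
under eq_bigr => t _.
  rewrite (@integral_row_perm (fun x => (h x)%:E)) //; last exact/measurable_EFinP.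
  over.
rewrite GRing.sumr_const; set c := \int[P]_w _.
rewrite (_ : (c *+ _)%R = n`!%:R%:E * c); last by rewrite mule_natl -card_Sn.
rewrite muleA -EFinM mulVf ?mul1e // pnatr_eq0 -lt0n; exact: fact_gt0.
Qed.

End Exchangeable.

Section AlmostSurely.
Context {dT : measure_display} {T : measurableType dT} {R : realType}.
Variables (P : probability T R) (n d : nat) (X : 'I_n -> T -> 'rV[R]_d.+1).
Hypotheses (mX : forall i, measurable_fun [set: T] (X i : T -> borel 'rV[R]_d.+1))
  (exchX : exchangeable P X)
  (genpos : {ae P, forall w, general_position n (fun k => partial_sum X k w)}).

(** The singular step matrices form a Borel set, so exchangeability carries their probability 0 from
    the given order to each of the finitely many orders. *)
Lemma ae_affine_general_perm :
  {ae P, forall w, affine_general_perm (steps X w)}.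
Proof.
pose B : set (borel 'M[R]_(n, d.+1)) :=
  [set x | nonsingular_samples (n := n) (walk x)].
have mB : measurable (~` B) by apply: measurableC; exact: measurable_nonsingular.
have : {ae P, forall w, forall t : 'S_n, B (row_perm t (steps X w))}.
  apply: filter_forall => t.
  have mN : measurable ((fun w => row_perm t (steps X w)) @^-1` (~` B)).
    rewrite -[X in measurable X]setTI.
    exact: (measurable_row_perm_steps mX t measurableT mB).
  apply/(negligibleP P mN); apply: etrans (exchangeable_pushforward exchX t mB) _.
  have mN1 : measurable (steps X @^-1` (~` B)).
    by rewrite -[X in measurable X]setTI; exact: (measurable_steps mX measurableT mB).
  apply/(negligibleP P mN1).
  apply: negligibleS genpos => w nBw /general_position_nonsingular.
  apply: contra_not nBw.
  by rewrite -walk_steps.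
by apply: filterS => w; exact: nonsingular_affine_general_perm.
Qed.

End AlmostSurely.

(** * The facet sum and its weighted counterpart *)

Lemma measurable_sum_cond {dU : measure_display} {U : measurableType dU}
    {R : realType} (I : finType) (p : pred I) (F : I -> U -> R) :
  (forall i, measurable_fun [set: U] (F i)) ->
  measurable_fun [set: U] (fun w => \sum_(i | p i) F i w).
Proof.
move=> mF; under eq_fun do rewrite big_mkcond.
by apply: measurable_sum => i; case: (p i).
Qed.

Section FacetSums.
Context {R : realType} {n d : nat}.
Variable g : 'M[R]_(d, d.+1) -> R.
Hypothesis g_ge0 : forall M, 0 <= g M.
Implicit Types x : 'M[R]_(n, d.+1).

(** The right-hand side of [facet_sumE] as a function of the step matrix, a form that makes its
    measurability accessible. *)
Definition facet_index_sum x : R :=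
  \sum_(i : d.+1.-tuple 'I_n.+1 | sorted ltn (map val i))
    (g (increments (walk x) (map val i)) *
       (on_one_side (n := n) 1 (walk x) (map val i))%:R +
     g (increments (walk x) (map val i)) *
       (on_one_side (n := n) (-1) (walk x) (map val i))%:R).

Definition gap_weighted_sum x : R :=
  2 * \sum_(j : d.-tuple 'I_n.+1 | sorted ltn (0%N :: map val j))
    g (increments (walk x) (0%N :: map val j)) / gap_prod (d := d) (0%N :: map val j).

(** The sides [e = 1] and [e = -1] contribute the same sum over permutations, whence the factor
    2. *)
Lemma sum_perm_facet_index_sum x : affine_general_perm x ->
  \sum_(t : 'S_n) facet_index_sum (row_perm t x) =
  \sum_(t : 'S_n) gap_weighted_sum (row_perm t x).
Proof.
move=> gx; rewrite -mulr_sumr mulr_natl mulr2n exchange_big /=.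
under eq_bigr do rewrite big_split /=.
rewrite big_split /= (sum_perm_one_side g (oner_neq0 _) gx).
rewrite (sum_perm_one_side g (e := -1)) ?oppr_eq0 ?oner_neq0 //.
by rewrite exchange_big.
Qed.

Lemma facet_index_sum_ge0 x : 0 <= facet_index_sum x.
Proof. by apply: sumr_ge0 => i _; rewrite addr_ge0 ?mulr_ge0. Qed.

Lemma gap_term_ge0 x (j : d.-tuple 'I_n.+1) : sorted ltn (0%N :: map val j) ->
  0 <= g (increments (walk x) (0%N :: map val j)) / gap_prod (d := d) (0%N :: map val j).
Proof.
move=> jS; rewrite divr_ge0 // ltW // gap_prod_gt0 //.
by rewrite /= size_map size_tuple.
Qed.

Lemma gap_weighted_sum_ge0 x : 0 <= gap_weighted_sum x.
Proof. by apply: mulr_ge0 => //; apply: sumr_ge0 => j; exact: gap_term_ge0. Qed.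

Hypothesis mg : measurable_fun [set: borel 'M[R]_(d, d.+1)]
  (g : borel 'M[R]_(d, d.+1) -> R).

Let mx_id : mx_measurable (fun x : borel 'M[R]_(n, d.+1) => x : 'M[R]_(n, d.+1)).
Proof. by move=> i j; exact: measurable_entry. Qed.

Let mg_incr s : measurable_fun [set: borel 'M[R]_(n, d.+1)]
  (fun x : borel 'M[R]_(n, d.+1) => g (increments (walk x) s)).
Proof. exact: (@measurable_increments_comp _ _ _ n d.+1 _ g s mg mx_id). Qed.

Lemma measurable_facet_index_sum :
  measurable_fun [set: borel 'M[R]_(n, d.+1)]
    (facet_index_sum : borel 'M[R]_(n, d.+1) -> R).
Proof.
apply: measurable_sum_cond => i; apply: measurable_funD;
  by apply: measurable_funM => //; exact: measurable_on_one_side.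
Qed.

Lemma measurable_gap_weighted_sum :
  measurable_fun [set: borel 'M[R]_(n, d.+1)]
    (gap_weighted_sum : borel 'M[R]_(n, d.+1) -> R).
Proof.
apply: measurable_funM; first exact: measurable_cst.
apply: measurable_sum_cond => i; apply: measurable_funM => //.
Qed.

End FacetSums.

Theorem theorem4 (dT : measure_display) (T : measurableType dT) (R : realType)
    (P : probability T R) (d n : nat) (hd : (1 <= d)%N) (hn : (d <= n)%N)
    (X : 'I_n -> T -> 'rV[R]_d)
    (mX : forall i, measurable_fun [set: T] (X i : T -> borel 'rV[R]_d))
    (exchX : exchangeable P X)
    (genpos : {ae P, forall w,
       general_position n (fun k => partial_sum X k w)})
    (g : 'M[R]_(d.-1, d) -> R)
    (mg : measurable_fun [set: borel 'M[R]_(d.-1, d)]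
            (g : borel 'M[R]_(d.-1, d) -> R))
    (g_ge0 : forall M, 0 <= g M) :
  ('E_P[fun w => facet_sum n g (fun k => partial_sum X k w)] =
   2%:E * \sum_(i : d.-1.-tuple 'I_n.+1 | sorted ltn (0%N :: map val i))
     ('E_P[fun w => g (increments (fun k => partial_sum X k w)
                                  (0%N :: map val i))] /
      (\prod_(j < d.-1)
         (nth 0%N (0%N :: map val i) j.+1
          - nth 0%N (0%N :: map val i) j)%N%:R)%:E))%E.
Proof.
case: d hd hn X mX exchX genpos g mg g_ge0 => [//|d] _ dn X mX exchX genpos.
move=> g mg g_ge0.
have agX := ae_affine_general_perm mX exchX genpos.
pose H : borel 'M[R]_(n, d.+1) -> R := facet_index_sum g.
pose K : borel 'M[R]_(n, d.+1) -> R := gap_weighted_sum g.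
have mH : measurable_fun setT H by exact: measurable_facet_index_sum.
have mK : measurable_fun setT K by exact: measurable_gap_weighted_sum.
have H0 x : 0 <= H x by exact: facet_index_sum_ge0.
have K0 x : 0 <= K x by exact: gap_weighted_sum_ge0.
have mavg (h : borel 'M[R]_(n, d.+1) -> R) : measurable_fun setT h ->
    measurable_fun setT (fun w =>
      (n`!%:R^-1 * \sum_(t : 'S_n) h (row_perm t (steps X w)))%:E).
  move=> mh; apply/measurable_EFinP/measurable_funM => //.
  apply: measurable_sum => t.
  exact: (measurableT_comp mh (measurable_row_perm_steps mX t)).
have avg0 (h : borel 'M[R]_(n, d.+1) -> R) w : (forall x, 0 <= h x) ->
    (0 <= (n`!%:R^-1 * \sum_(t : 'S_n) h (row_perm t (steps X w)))%:E)%E.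
  by move=> h0; rewrite lee_fin mulr_ge0 // sumr_ge0.
(* The facet sum is almost surely [H]; [H] and [K] are exchanged for their averages over
   permutations, which agree almost surely. *)
transitivity (\int[P]_w (K (steps X w))%:E)%E.
  rewrite unlock (integral_average mX exchX mK K0).
  transitivity (\int[P]_w (H (steps X w))%:E)%E.
    apply: ae_eq_lower_integral.
    - move=> w; rewrite lee_fin; apply: fsumr_ge0 => F _; exact: g_ge0.
    - by move=> w; rewrite lee_fin.
    - exact/measurable_EFinP/(measurableT_comp mH (measurable_steps mX)).
    apply: filterS agX => w /(_ 1%g); rewrite row_perm1 walk_steps => agw.
    by rewrite (facet_sumE dn agw) /H /facet_index_sum walk_steps.
  rewrite (integral_average mX exchX mH H0).
  apply: ae_eq_lower_integral.
  - by move=> w; exact: avg0.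
  - by move=> w; exact: avg0.
  - exact: mavg.
  by apply: filterS agX => w /sum_perm_facet_index_sum ->.
have mterm (s : seq nat) : measurable_fun [set: T]
    (fun w => g (increments (walk (steps X w)) s)).
  exact: (@measurable_increments_comp _ _ _ n d.+1 _ g s mg (mx_measurable_steps mX)).
under eq_integral do rewrite EFinM -sumEFin big_mkcond.
(* The value 0 on tuples that are not increasing turns the sum into one over all tuples, ready for
   exchange with the integral. *)
pose F (j : d.-tuple 'I_n.+1) w : \bar R := if sorted ltn (0%N :: map val j) then
  (g (increments (walk (steps X w)) (0%N :: map val j)) /
     gap_prod (d := d) (0%N :: map val j))%:E else 0%E.
have F0 j w : (0 <= F j w)%E.
  by rewrite /F; case: ifP => // jS; rewrite lee_fin; exact: gap_term_ge0.
have mF j : measurable_fun [set: T] (F j).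
  rewrite /F; case: (sorted _ _) => //.
  by apply/measurable_EFinP/measurable_funM.
rewrite ge0_integralZl_EFin //; last 2 first.
- by move=> w _; apply: sume_ge0 => j _; exact: F0.
- exact: (emeasurable_sum _ mF).
congr (_ * _)%E.
rewrite (ge0_integral_sum _ measurableT mF) //.
rewrite [RHS]big_mkcond /=; apply: eq_bigr => j _; rewrite /F /=.
case: ifPn => jS; last by rewrite integral0_eq // => w _.
have gap_gt0 : 0 < gap_prod (d := d) (0%N :: map val j) :> R.
  by apply: gap_prod_gt0 => //; rewrite /= size_map size_tuple.
(* Positivity of the gap product makes the extended-real quotient a product with a real inverse,
   which enters the integral. *)
rewrite unlock inver gt_eqF // muleC -ge0_integralZl_EFin //; last 3 first.
- by move=> w _; rewrite lee_fin.
- apply/measurable_EFinP; under eq_fun do rewrite -walk_steps; exact: mterm.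
- by rewrite invr_ge0 ltW.
by apply: eq_integral => w _; rewrite -walk_steps EFinM muleC.
Qed.
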